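(* Let $d\ge 1$, let $X=(X^{(1)},\dots,X^{(d)})$ be uniformly distributed in $[0,1]^d$, and let $Y=m(X)+\epsilon$, where $\epsilon$ is a zero-mean Gaussian noise with finite variance, independent of $X$, and $m:[0,1]^d\to\mathbb{R}$ is a Lipschitz function. Let $(X_1,Y_1),(X_2,Y_2),\dots$ be independent copies of $(X,Y)$. Then there exist depths $k=k_n\in\mathbb{N}$ with $k_n\to\infty$ as $n\to\infty$, and a constant $\tilde C$ (independent of $n$ and $x$), such that for every integer $n>1$ and every $x\in[0,1]^d$, $$\mathbb{E}\big(\tilde m^{Cen}_{\infty,n}(x)-m(x)\big)^2\le \tilde C\, n^{-\left(\frac{1}{1+d\log 2}\right)}\,(\log n),$$ where $\tilde m^{Cen}_{\infty,n}$ is the infinite centered KeRF estimator of depth $k=k_n$ built from $(X_1,Y_1),\dots,(X_n,Y_n)$.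
   Context: $\log$ is the natural logarithm. Lipschitz means that there is $L$ with $|m(x)-m(x')|\le L\sum_{j=1}^d|x_j-x_j'|$ for all $x,x'\in[0,1]^d$. The centered random forest kernel with depth parameter $k\in\mathbb{N}$ is, for $x,z\in[0,1]^d$, $$K^{Cen}_k(x,z)=\sum_{k_1+\dots+k_d=k}\frac{k!}{k_1!\cdots k_d!}\Big(\frac1d\Big)^k\prod_{j=1}^d \mathbf{1}_{\lceil 2^{k_j}x_j\rceil=\lceil 2^{k_j}z_j\rceil},$$ the sum being over $(k_1,\dots,k_d)$ of nonnegative integers with sum $k$. (It is the probability that $x$ and $z$ lie in the same cell when $[0,1]^d$ is split $k$ times in succession, each time every current cell being split at the midpoint of a side in a coordinate direction chosen uniformly at random.) A zero coordinate is assigned to the first dyadic interval, i.e. in this formula $\lceil 0\rceil$ is read as $1$. The infinite centered KeRF estimator of depth $k$ built from $(X_1,Y_1),\dots,(X_n,Y_n)$ is $$\tilde m^{Cen}_{\infty,n}(x)=\frac{\sum_{i=1}^n Y_i K^{Cen}_k(x,X_i)}{\sum_{i=1}^n K^{Cen}_k(x,X_i)},$$ with the convention $0/0=0$. The expectation is over the data $(X_1,Y_1),\dots,(X_n,Y_n)$. *)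

(* Defs.v *)
From HB Require Import structures.
From mathcomp Require Import all_boot all_order all_algebra.
From mathcomp Require Import all_classical all_reals all_analysis.

Set Implicit Arguments.
Unset Strict Implicit.
Unset Printing Implicit Defensive.

Import Order.TTheory GRing.Theory Num.Theory.
Import numFieldNormedType.Exports.

Local Open Scope classical_set_scope.
Local Open Scope ring_scope.

(* Points of R^d are d-tuples of reals; the library equips [d.-tuple R] with the
   sigma-algebra generated by the coordinates, i.e. the Borel sigma-algebra. *)

Definition unit_cube (R : realType) (d : nat) : set (d.-tuple R) :=
  [set x | forall j : 'I_d, 0 <= tnth x j <= 1].

Definition lipschitz_on_cube (R : realType) (d : nat) (m : d.-tuple R -> R) :=
  exists L : R, forall x x' : d.-tuple R,
    unit_cube x -> unit_cube x' ->
    `|m x - m x'| <= L * \sum_(j < d) `|tnth x j - tnth x' j|.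

(* [measurableTypeR R] is R with the sigma-algebra on which the library defines
   [uniform_prob]; it has the same measurable sets as the default instance. *)
Definition cons_pair (R : realType) (d : nat)
  (p : measurableTypeR R * d.-tuple R) : d.+1.-tuple R :=
  [the d.+1.-tuple R of (p.1 : R) :: p.2].

Lemma measurable_cons_pair (R : realType) (d : nat) :
  measurable_fun setT (@cons_pair R d).
Proof.
apply: (@measurable_cons _ _ _ R (fun p => p.1)).
- exact: measurable_fst.
- exact: measurable_snd.
Qed.

HB.instance Definition _ (R : realType) (d : nat) :=
  @isMeasurableFun.Build _ _ (measurableTypeR R * d.-tuple R)%type
    (d.+1.-tuple R) (@cons_pair R d) (@measurable_cons_pair R d).

(* The uniform distribution on [0,1]^d, as the d-fold product of the uniform
   distribution on [0,1]; [cons_pair] identifies R x R^d with R^(d+1). *)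
Fixpoint uniform_cube (R : realType) (d : nat) : probability (d.-tuple R) R :=
  match d return probability (d.-tuple R) R with
  | 0 => \d_([tuple] : 0.-tuple R)
  | d'.+1 => distribution (uniform_prob (@ltr01 R) \x uniform_cube R d')%E
               (@cons_pair R d')
  end.

(* The centered Gaussian law with standard deviation [s]. The variance 0 is
   allowed, and then the law is the Dirac mass at 0; this case is separate
   because the library's [normal_prob 0 0] is uniform on [0,1]. *)
Definition centered_gaussian (R : realType) (s : R) : set R -> \bar R :=
  if s == 0 then \d_(0 : R) else normal_prob 0 s.

(* Distributions are compared on measurable sets only: measures are total
   functions on sets, with unspecified values elsewhere. *)
Definition has_law d d' (T : measurableType d) (U : measurableType d')
    (R : realType) (P : probability T R) (Z : T -> U)
    (Q : set U -> \bar R) :=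
  forall A : set U, measurable A -> P (Z @^-1` A) = Q A.

Definition independent_pair d d1 d2 (T : measurableType d)
    (U1 : measurableType d1) (U2 : measurableType d2)
    (R : realType) (P : probability T R) (Z1 : T -> U1) (Z2 : T -> U2) :=
  forall (A : set U1) (B : set U2), measurable A -> measurable B ->
    P (Z1 @^-1` A `&` Z2 @^-1` B) = (P (Z1 @^-1` A) * P (Z2 @^-1` B))%E.

Definition mutually_independent d d' (T : measurableType d)
    (U : measurableType d') (R : realType) (P : probability T R)
    (Z : nat -> T -> U) :=
  forall (s : seq nat) (A : nat -> set U), uniq s ->
    (forall i, measurable (A i)) ->
    P (\bigcap_(i in [set` s]) (Z i @^-1` A i)) =
      (\prod_(i <- s) P (Z i @^-1` A i))%E.

Definition independent_copies d d' (T : measurableType d)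
    (U : measurableType d') (R : realType) (P : probability T R)
    (Z : nat -> T -> U) (Z0 : T -> U) :=
  mutually_independent P Z /\ forall i, has_law P (Z i) (pushforward P Z0).

(* The ceiling of 2^k t, with the ceiling of 0 read as 1. *)
Definition dyadic_index (R : realType) (k : nat) (t : R) : int :=
  if 2 ^+ k * t == 0 then 1 else Num.ceil (2 ^+ k * t).

(* The multi-indices (k_1, ..., k_d) with sum k are the finite functions
   c : 'I_d -> {0, ..., k} with sum k. *)
Definition centered_kernel (R : realType) (d k : nat) (x z : d.-tuple R) : R :=
  \sum_(c : {ffun 'I_d -> 'I_k.+1} | (\sum_(j < d) (c j : nat))%N == k)
    (k`!)%:R / (\prod_(j < d) (c j)`!)%:R * (1 / d%:R) ^+ k *
    \prod_(j < d)
      (dyadic_index (c j) (tnth x j) == dyadic_index (c j) (tnth z j))%:R.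

(* The sample is indexed from 0. Since 0^-1 = 0 in a field of the library, the
   quotient is 0 when its denominator is. *)
Definition centered_kerf (R : realType) (d k n : nat)
    (Xs : nat -> d.-tuple R) (Ys : nat -> R) (x : d.-tuple R) : R :=
  (\sum_(i < n) Ys i * centered_kernel k x (Xs i)) /
  (\sum_(i < n) centered_kernel k x (Xs i)).

(* Main.v *)
Require Import Defs.
From HB Require Import structures.
From mathcomp Require Import all_boot all_order all_algebra.
From mathcomp Require Import all_classical all_reals all_analysis.
From mathcomp Require Import measurable_realfun ring lra.

Set Implicit Arguments.
Unset Strict Implicit.
Unset Printing Implicit Defensive.

Import Order.TTheory GRing.Theory Num.Theory.
Import numFieldNormedType.Exports.

Local Open Scope classical_set_scope.
Local Open Scope ring_scope.

(** The risk is the sum of a bias, which decreases with the depth [k], and of a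
    stochastic term, which increases with it. Write [K_i] for the kernel at
    [(x, X_i)], [S] for the sum of the [K_i], and [V_i = Y_i - m x].

    _Size of the weights._ The kernel is an average, over the multi-indices
    [(k_1, ..., k_d)] with sum [k], of indicators of dyadic boxes around [x],
    each of volume [2^-k]. Hence [E K_i = q := 2^-k], [E S = mu := n q], and,
    since [0 <= K_i <= 1], the variance of [S] is at most [mu].

    _Random denominator._ If [e * S = N], then [e = N / mu + e * (mu - S) / mu],
    so that [e^2 <= 2 N^2 / mu^2 + 2 e^2 (S - mu)^2 / mu^2]. For a bounded [e]
    this bounds the second moment of the self-normalized sum [e] by moments of
    the linear statistics [N] and [S]. It is applied pointwise, with [S]
    possibly zero, in [pointwise_risk_le], and integrated in [discrete_risk_le].

    _Conditioning._ The kernel at [(x, z)] depends on [z] only through the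
    finitely many booleans which record the dyadic intervals that [z] shares
    with [x]: the pattern of [z]. Given the patterns of the whole sample, the
    weights [w_i = K_i / S] are constants and the [V_i] are independent, with
    conditional means [b_i] bounded by the oscillation of [m], so that the
    conditional second moment of the error is at most
    [(sum w_i b_i)^2 + Q sum w_i^2 + (m x)^2 1_(S = 0)]. Patterns range over a
    finite type, hence the product rule for measurable rectangles is all that
    is required of independence, and the expectation over the patterns is a
    finite sum with product weights. The result is [partition_risk_le]: the risk
    is at most [A / mu + 2 (E (K V) / q)^2].

    _Bias._ On the box of [(k_1, ..., k_d)], [|m X - m x| <= L sum_j 2^-k_j];
    the multinomial theorem averages this to
    [|E (K V)| / q <= L d (1 - 1/(2d))^k]. Therefore the risk at depth [k] is at
    most [A 2^k / n + 2 (L d)^2 (1 - 1/(2d))^(2k)] ([kerf_risk_le]).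

    _Choice of the depth._ As [1 - 1/(2d) <= exp (-1/(2d))], the squared bias is at most
    of order [exp (-k/d)]. This balances [2^k / n] for
    [k = floor (d log n / (1 + d log 2))], when both are of order
    [n^(-1 / (1 + d log 2))]. The constant absorbs [1 / log 2], because
    [log n >= log 2]. *)

(** * The multinomial theorem *)

Section multinomial.
Variable F : numFieldType.

Definition truncated_exp (k : nat) (y : F) : {poly F} :=
  \sum_(i < k.+1) (y ^+ i / i`!%:R) *: 'X^i.

Lemma natr_fact_neq0 n : (n`!%:R : F) != 0.
Proof. by rewrite pnatr_eq0 -lt0n fact_gt0. Qed.

Lemma coef_truncated_exp k (y : F) i : (i <= k)%N ->
  (truncated_exp k y)`_i = y ^+ i / i`!%:R.
Proof.
move=> ik; rewrite /truncated_exp -(poly_def _ (fun i => y ^+ i / i`!%:R)).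
by rewrite coef_poly ltnS ik.
Qed.

Lemma coef_prod_truncated_exp (d k i : nat) (y : 'I_d -> F) : (i <= k)%N ->
  (\prod_(j < d) truncated_exp k (y j))`_i = (\sum_(j < d) y j) ^+ i / i`!%:R.
Proof.
elim: d i y => [|d IH] i y ik.
  rewrite !big_ord0 coef1 expr0n; case: i ik => [|i] _ /=; last by rewrite mul0r.
  by rewrite fact0 divr1.
rewrite !big_ord_recl coefMr exprDn mulr_suml; apply: eq_bigr => -[l li] _ /=.
rewrite ltnS in li.
rewrite IH ?(leq_trans li ik)// coef_truncated_exp ?(leq_trans (leq_subr _ _) ik)//.
rewrite -(bin_fact li) !natrM -mulr_natr.
field; rewrite !natr_fact_neq0 /= pnatr_eq0 -lt0n bin_gt0.
by rewrite li.
Qed.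

(** Both sides are [k!] times the coefficient of ['X^k] in the product of the
    truncated exponential series of the [y j], which is the truncated series of
    the sum of the [y j] up to degree [k]. *)
Lemma multinomial_theorem (d k : nat) (y : 'I_d -> F) :
  \sum_(c : {ffun 'I_d -> 'I_k.+1} | (\sum_(j < d) (c j : nat))%N == k)
    (k`!)%:R / (\prod_(j < d) (c j)`!)%:R * \prod_(j < d) y j ^+ c j =
  (\sum_(j < d) y j) ^+ k.
Proof.
have -> : (\sum_(j < d) y j) ^+ k =
    k`!%:R * (\prod_(j < d) truncated_exp k (y j))`_k.
  by rewrite coef_prod_truncated_exp// mulrCA divff ?mulr1 ?natr_fact_neq0.
rewrite /truncated_exp bigA_distr_bigA /= coef_sum mulr_sumr.
rewrite big_mkcond; apply: eq_bigr => c _ /=.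
rewrite (eq_bigr (fun j => (y j ^+ c j / (c j)`!%:R)%:P * 'X^(c j))); last first.
  by move=> j _; rewrite mul_polyC.
rewrite big_split /= -rmorph_prod prodrXr coefCM coefXn eq_sym.
case: ifPn => _; last by rewrite !mulr0.
by rewrite mulr1 prodf_div natr_prod; field; apply/prodf_neq0 => j _; exact: natr_fact_neq0.
Qed.

End multinomial.

(** * Self-normalized sums under a finite product law *)

Section product_weights.
Variables (R : realFieldType) (F : finType) (p : F -> R).
Hypothesis p_ge0 : forall a, 0 <= p a.
Hypothesis p_sum1 : \sum_a p a = 1.

Definition mean (f : F -> R) : R := \sum_a p a * f a.
Definition product_weight n (alpha : {ffun 'I_n -> F}) : R := \prod_i p (alpha i).

Lemma product_weight_ge0 n (alpha : {ffun 'I_n -> F}) : 0 <= product_weight alpha.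
Proof. by rewrite prodr_ge0. Qed.

Lemma mean_cst (r : R) : mean (fun=> r) = r.
Proof. by rewrite /mean -mulr_suml p_sum1 mul1r. Qed.

Lemma ler_mean (f g : F -> R) : (forall a, f a <= g a) -> mean f <= mean g.
Proof. by move=> fg; apply: ler_sum => a _; rewrite ler_wpM2l. Qed.

Lemma meanZ (r : R) f : mean (fun a => r * f a) = r * mean f.
Proof. by rewrite /mean mulr_sumr; apply: eq_bigr => a _; rewrite mulrCA. Qed.

Lemma meanD f g : mean (fun a => f a + g a) = mean f + mean g.
Proof. by rewrite /mean -big_split; apply: eq_bigr => a _; rewrite mulrDr. Qed.

Lemma sum_product_weight n (g : 'I_n -> F -> R) :
  \sum_(alpha : {ffun 'I_n -> F}) product_weight alpha * \prod_i g i (alpha i) =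
  \prod_i mean (g i).
Proof.
rewrite /mean bigA_distr_bigA /=; apply: eq_bigr => alpha _.
by rewrite -big_split.
Qed.

Lemma sum_product_weight1 n (i : 'I_n) f :
  \sum_(alpha : {ffun 'I_n -> F}) product_weight alpha * f (alpha i) = mean f.
Proof.
pose g l a := if l == i then f a else 1.
have <- : \prod_l mean (g l) = mean f.
  rewrite (bigD1 i)//= /g eqxx big1 ?mulr1// => l /negPf ->; exact: mean_cst.
rewrite -sum_product_weight; apply: eq_bigr => alpha _.
rewrite (bigD1 i)//= /g eqxx big1 ?mulr1// => l /negPf ->//.
Qed.

Lemma sum_product_weight2 n (i j : 'I_n) f g : i != j ->
  \sum_(alpha : {ffun 'I_n -> F}) product_weight alpha * (f (alpha i) * g (alpha j)) =
  mean f * mean g.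
Proof.
move=> ij; pose h l a := if l == i then f a else if l == j then g a else 1.
have ji : (j == i) = false by rewrite eq_sym (negPf ij).
have <- : \prod_l mean (h l) = mean f * mean g.
  rewrite (bigD1 i)//= (bigD1 j) ?ji//= /h eqxx ji eqxx big1 ?mulr1//.
  by move=> l /andP[/negPf -> /negPf ->]; exact: mean_cst.
rewrite -sum_product_weight; apply: eq_bigr => alpha _.
rewrite (bigD1 i)//= (bigD1 j) ?ji//= /h eqxx ji eqxx big1 ?mulr1//.
by move=> l /andP[/negPf -> /negPf ->].
Qed.

Lemma sum_product_weight_sum n f :
  \sum_(alpha : {ffun 'I_n -> F}) product_weight alpha * (\sum_i f (alpha i)) =
  n%:R * mean f.
Proof.
under eq_bigr do rewrite mulr_sumr.
rewrite exchange_big /= (eq_bigr (fun=> mean f)) => [|i _].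
  by rewrite sumr_const card_ord mulr_natl.
exact: sum_product_weight1.
Qed.

(** Off the diagonal the terms factor, which gives at most the square of the
    mean of the sum; the diagonal gives the first term of the bound. With a
    centered [f] this is the bound on the variance. *)
Lemma sum_product_weight_sqr n f :
  \sum_(alpha : {ffun 'I_n -> F}) product_weight alpha * (\sum_i f (alpha i)) ^+ 2
  <= n%:R * mean (fun a => f a ^+ 2) + (n%:R * mean f) ^+ 2.
Proof.
have -> : n%:R * mean (fun a => f a ^+ 2) = \sum_(i < n) mean (fun a => f a ^+ 2).
  by rewrite sumr_const card_ord mulr_natl.
have -> : (n%:R * mean f) ^+ 2 = \sum_(i < n) \sum_(j < n) mean f ^+ 2.
  by rewrite !sumr_const card_ord -mulrnA -[in RHS]mulr_natl natrM; ring.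
rewrite -big_split /=.
under eq_bigr do rewrite expr2 mulr_suml mulr_sumr.
rewrite exchange_big /=; apply: ler_sum => i _.
under eq_bigr do rewrite mulr_sumr mulr_sumr.
rewrite exchange_big /= (bigD1 i)//= (sum_product_weight1 i (fun a => f a * f a)).
rewrite lerD2l.
rewrite [leRHS](bigD1 i)//= -[leLHS]add0r lerD ?sqr_ge0//.
rewrite le_eqVlt; apply/orP; left; apply/eqP/eq_bigr => j ji.
by rewrite sum_product_weight2 ?expr2// eq_sym.
Qed.

(** [b] stands for the conditional means of the responses given the cells, [Q]
    for a bound on their conditional second moments, and [c] for the error made
    when all weights vanish. *)
Section ratio.
Variables (kappa b : F -> R) (B Q c : R) (n : nat).
Hypothesis kappa_ge0 : forall a, 0 <= kappa a.
Hypothesis kappa_le1 : forall a, kappa a <= 1.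
Hypothesis b_le : forall a, `|b a| <= B.
Hypothesis B_ge0 : 0 <= B.
Hypothesis Q_ge0 : 0 <= Q.

Definition total_weight (alpha : {ffun 'I_n -> F}) : R := \sum_l kappa (alpha l).
Definition weight (alpha : {ffun 'I_n -> F}) (i : 'I_n) : R :=
  kappa (alpha i) / total_weight alpha.

Lemma total_weight_ge0 alpha : 0 <= total_weight alpha.
Proof. by rewrite sumr_ge0. Qed.

Lemma weight_ge0 alpha i : 0 <= weight alpha i.
Proof. by rewrite divr_ge0// total_weight_ge0. Qed.

Lemma sum_weight alpha : \sum_i weight alpha i = (total_weight alpha != 0)%:R.
Proof.
rewrite -mulr_suml -/(total_weight alpha).
by have [->|?] := eqVneq; rewrite ?mul0r// divff.
Qed.

Lemma sum_sqr_weight_le1 alpha : \sum_i weight alpha i ^+ 2 <= 1.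
Proof.
apply: (@le_trans _ _ (\sum_i weight alpha i)); last first.
  by rewrite sum_weight; case: (_ != _); rewrite ?lexx.
apply: ler_sum => i _; rewrite expr2 ler_piMr ?weight_ge0//.
apply: (@le_trans _ _ (\sum_i weight alpha i)); last first.
  by rewrite sum_weight; case: (_ != _); rewrite ?lexx.
rewrite (bigD1 i)//= lerDl sumr_ge0// => *; exact: weight_ge0.
Qed.

Lemma sum_sqr_weight_total alpha :
  (\sum_i weight alpha i ^+ 2) * total_weight alpha <= 1.
Proof.
rewrite mulr_suml.
apply: (@le_trans _ _ (\sum_i weight alpha i)); last first.
  by rewrite sum_weight; case: (_ != _); rewrite ?lexx.
apply: ler_sum => i _; rewrite expr2 -mulrA ler_piMr ?weight_ge0//.
rewrite /weight -mulrA; have [->|?] := eqVneq (total_weight alpha) 0.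
  by rewrite !mulr0.
by rewrite mulVf// mulr1.
Qed.

(** The identity holds also when the total weight is zero, since then each
    [kappa (alpha i)] is zero. *)
Lemma sum_weight_total alpha :
  (\sum_i weight alpha i * b (alpha i)) * total_weight alpha =
  \sum_i kappa (alpha i) * b (alpha i).
Proof.
rewrite mulr_suml; apply: eq_bigr => i _.
have [S0|S0] := eqVneq (total_weight alpha) 0; last first.
  by rewrite /weight; field.
have -> : kappa (alpha i) = 0.
  apply/le_anti; rewrite kappa_ge0 andbT -S0 /total_weight (bigD1 i)//= lerDl.
  by rewrite sumr_ge0.
by rewrite S0 mulr0 mul0r.
Qed.

Lemma norm_sum_weight alpha : `|\sum_i weight alpha i * b (alpha i)| <= B.
Proof.
apply: (le_trans (ler_norm_sum _ _ _)).
apply: (@le_trans _ _ (\sum_i weight alpha i * B)).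
  apply: ler_sum => i _; rewrite normrM ger0_norm ?weight_ge0//.
  by rewrite ler_wpM2l ?weight_ge0.
rewrite -mulr_suml sum_weight.
by case: eqP => _ /=; rewrite ?mul1r// mul0r.
Qed.

(** Let [S] be the total weight. The squared average and the sum of squared
    weights are both bounded quantities [t] to which
    [t mu^2 <= 2 t S^2 + 2 t (S - mu)^2] applies: the factor [S^2] cancels the
    denominators of the weights in the first summand, and the boundedness of
    [t] serves in the second. If [S = 0], then [mu^2 = (S - mu)^2]. *)
Lemma pointwise_risk_le (mu : R) alpha : 0 < mu ->
  (\sum_i weight alpha i * b (alpha i)) ^+ 2 +
    Q * (\sum_i weight alpha i ^+ 2) + c ^+ 2 * (total_weight alpha == 0)%:R <=
  (2 * (\sum_i kappa (alpha i) * b (alpha i)) ^+ 2 +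
   2 * Q * total_weight alpha +
   (2 * B ^+ 2 + 2 * Q + c ^+ 2) * (total_weight alpha - mu) ^+ 2) / mu ^+ 2.
Proof.
move=> mu0; rewrite ler_pdivlMr ?exprn_gt0//.
rewrite -sum_weight_total.
have := norm_sum_weight alpha; set r := \sum_i _ * _ => rB.
have := sum_sqr_weight_le1 alpha; have := sum_sqr_weight_total alpha.
have : 0 <= \sum_i weight alpha i ^+ 2 by rewrite sumr_ge0// => *; exact: sqr_ge0.
set v := \sum_i _ ^+ 2; have := total_weight_ge0 alpha.
set S := total_weight alpha => S0 v0 vS v1.
rewrite !mulrDl; rewrite addrAC [leRHS]addrACA -addrA.
have r2 : r ^+ 2 <= B ^+ 2 by rewrite -real_normK ?num_real// ler_sqr ?nnegrE.
have h1 : r ^+ 2 * mu ^+ 2 <= 2 * (r * S) ^+ 2 + 2 * B ^+ 2 * (S - mu) ^+ 2.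
  apply: (@le_trans _ _ (2 * (r * S) ^+ 2 + 2 * (r ^+ 2 * (S - mu) ^+ 2))).
    by rewrite -subr_ge0; apply: (le_trans (sqr_ge0 (r * (2 * S - mu)))); lra.
  by rewrite lerD2l -mulrA ler_pM2l// ler_wpM2r// sqr_ge0.
have h2 : v * mu ^+ 2 <= 2 * S + 2 * (S - mu) ^+ 2.
  apply: (@le_trans _ _ (2 * (v * S * S) + 2 * (v * (S - mu) ^+ 2))).
    rewrite -subr_ge0.
    apply: (@le_trans _ _ (v * (2 * S - mu) ^+ 2)); first by rewrite mulr_ge0// sqr_ge0.
    lra.
  rewrite lerD// ler_pM2l//; first by rewrite ler_piMl.
  by rewrite ler_piMl// sqr_ge0.
have h3 : (S == 0)%:R * mu ^+ 2 <= (S - mu) ^+ 2.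
  by case: eqP => [->|_] /=; rewrite ?mul0r ?sqr_ge0// mul1r sub0r sqrrN.
have := ler_wpM2l Q_ge0 h2; have := ler_wpM2l (sqr_ge0 c) h3.
lra.
Qed.

(** The pointwise bound is integrated. As [kappa^2 <= kappa], both the variance
    of the total weight and the sum of the [kappa^2 b^2], up to the factor
    [B^2], are at most [mu = n q]. *)
Lemma discrete_risk_le (q := mean kappa) : (0 < n)%N -> 0 < q ->
  \sum_(alpha : {ffun 'I_n -> F}) product_weight alpha *
   ((\sum_i weight alpha i * b (alpha i)) ^+ 2 +
    Q * (\sum_i weight alpha i ^+ 2) + c ^+ 2 * (total_weight alpha == 0)%:R) <=
  (4 * B ^+ 2 + 4 * Q + c ^+ 2) / (n%:R * q) +
  2 * (mean (fun a => kappa a * b a) / q) ^+ 2.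
Proof.
move=> n0 q0; set mu := n%:R * q.
have mu0 : 0 < mu by rewrite mulr_gt0// ltr0n.
apply: le_trans.
  apply: ler_sum => alpha _; apply: ler_wpM2l; first exact: product_weight_ge0.
  exact: (pointwise_risk_le alpha mu0).
under eq_bigr do rewrite mulrA.
rewrite -mulr_suml ler_pdivrMr ?exprn_gt0//.
under eq_bigr do rewrite !mulrDr.
rewrite !big_split /=.
under eq_bigr do rewrite mulrCA.
under [X in _ + X + _ <= _]eq_bigr do rewrite mulrCA.
under [X in _ + _ + X <= _]eq_bigr do rewrite mulrCA.
rewrite -!mulr_sumr sum_product_weight_sum -/q -/mu.
set N2 := \sum_alpha _ * (\sum_i _) ^+ 2.
set V2 := \sum_alpha _ * (_ - mu) ^+ 2.
have kq (a : F) : kappa a ^+ 2 <= kappa a by rewrite expr2 ler_piMr.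
have hN : N2 <= B ^+ 2 * mu + (n%:R * mean (fun a => kappa a * b a)) ^+ 2.
  apply: (le_trans (sum_product_weight_sqr _ (fun a => kappa a * b a))).
  rewrite lerD2r /mu mulrCA ler_wpM2l ?ler0n// -meanZ; apply: ler_mean => a.
  rewrite exprMn mulrC ler_pM ?sqr_ge0//.
  by rewrite -real_normK ?num_real// ler_sqr ?nnegrE.
(* The total weight minus its mean is a sum of centered terms. *)
have hV : V2 <= mu.
  have -> : V2 = \sum_(alpha : {ffun 'I_n -> F})
      product_weight alpha * (\sum_i (kappa (alpha i) - q)) ^+ 2.
    apply: eq_bigr => alpha _; congr (_ * _ ^+ 2).
    by rewrite sumrB sumr_const card_ord -mulr_natl.
  apply: (le_trans (sum_product_weight_sqr _ (fun a => kappa a - q))).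
  rewrite meanD mean_cst subrr mulr0 expr0n addr0 /mu ler_wpM2l ?ler0n//.
  apply: (@le_trans _ _ (mean (fun a => kappa a + (- (2 * q) * kappa a + q ^+ 2)))).
    apply: ler_mean => a; have := kq a; lra.
  rewrite meanD meanD meanZ mean_cst -/q; have := sqr_ge0 q; lra.
have E : (n%:R * mean (fun a => kappa a * b a)) ^+ 2 =
    (mean (fun a => kappa a * b a) / q) ^+ 2 * mu ^+ 2.
  by rewrite /mu; field; exact: lt0r_neq0.
rewrite [leRHS]mulrDl.
have -> : (4 * B ^+ 2 + 4 * Q + c ^+ 2) / mu * mu ^+ 2 = (4 * B ^+ 2 + 4 * Q + c ^+ 2) * mu.
  by field; exact: lt0r_neq0.
rewrite -[X in _ <= _ + X]mulrA -E.
have h0 : 0 <= 2 * B ^+ 2 + 2 * Q + c ^+ 2.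
  by rewrite !addr_ge0 ?sqr_ge0// mulr_ge0// sqr_ge0.
have := ler_wpM2l h0 hV.
move: hN; lra.
Qed.

End ratio.
End product_weights.

(** * Integration lemmas *)

(** The dominating function is [1 + f^2]; constants are integrable since [P] is
    finite. *)
Lemma integrable_of_sqr d (T : measurableType d) (R : realType)
    (P : probability T R) (f : T -> R) :
  measurable_fun setT f -> P.-integrable setT (fun w => (f w ^+ 2)%:E) ->
  P.-integrable setT (fun w => (f w)%:E).
Proof.
move=> mf f2.
have H : P.-integrable setT (fun w => (1 + f w ^+ 2)%:E).
  under eq_fun do rewrite EFinD; apply: integrableD => //.
  exact: finite_measure_integrable_cst.
apply: le_integrable H => //; first exact/measurable_EFinP.
move=> w _ /=; rewrite lee_fin [leRHS]ger0_norm ?addr_ge0 ?sqr_ge0//.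
rewrite ler_norml; apply/andP; split.
  by have := sqr_ge0 (f w + 1); nra.
by have := sqr_ge0 (f w - 1); nra.
Qed.

Section density.
Local Open Scope ereal_scope.
Context d (T : measurableType d) (R : realType).
Variables (mu nu : {measure set T -> \bar R}) (p : T -> R).
Hypothesis mp : measurable_fun setT p.
Hypothesis p_ge0 : forall x, (0 <= p x)%R.
Hypothesis nuE : forall A, measurable A -> nu A = \int[mu]_(x in A) (p x)%:E.

Import HBNNSimple.

(** The identity holds for indicators by hypothesis, hence for simple functions,
    and passes to nonnegative measurable functions by monotone convergence. *)
Lemma ge0_integral_density (f : T -> \bar R) :
  measurable_fun setT f -> (forall x, 0 <= f x) ->
  \int[nu]_x f x = \int[mu]_x (f x * (p x)%:E).
Proof.
move=> mf f0; pose f_ := nnsfun_approx measurableT mf.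
have mEp : measurable_fun setT (EFin \o p) by exact/measurable_EFinP.
transitivity (limn (fun n => \int[nu]_x (f_ n x)%:E)).
  rewrite -monotone_convergence//=.
  - apply: eq_integral => x _; apply/esym/cvg_lim => //.
    exact: cvg_nnsfun_approx.
  - by move=> n; exact/measurable_EFinP/measurable_funTS.
  - by move=> n x _; rewrite lee_fin.
  - by move=> x _ m n mn; rewrite lee_fin; exact/lefP/nd_nnsfun_approx.
transitivity (limn (fun n => \int[mu]_x ((f_ n x)%:E * (p x)%:E))); last first.
  rewrite -monotone_convergence//=.
  - apply: eq_integral => x _; apply/cvg_lim => //.
    apply: cvgeZr => //; exact: cvg_nnsfun_approx.
  - by move=> n; apply: emeasurable_funM => //; exact/measurable_EFinP.
  - by move=> n x _; rewrite mule_ge0// lee_fin.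
  - move=> x _ m n mn; rewrite lee_wpmul2r ?lee_fin//.
    exact/lefP/nd_nnsfun_approx.
congr (limn _); apply/funext => n.
under eq_integral do rewrite fimfunE -fsumEFin//.
rewrite ge0_integral_fsum//; last 2 first.
  - by move=> r; exact/measurable_EFinP/measurableT_comp.
  - by move=> r x _; rewrite EFinM nnfun_muleindic_ge0.
under [RHS]eq_integral.
  move=> x xD; rewrite fimfunE -fsumEFin// ge0_mule_fsuml; last first.
    by move=> r; rewrite EFinM nnfun_muleindic_ge0.
  over.
rewrite ge0_integral_fsum//; last 2 first.
  - move=> r; apply: emeasurable_funM => //.
    by apply/measurable_EFinP; exact: measurableT_comp.
  - move=> r x _; rewrite mule_ge0 ?(lee_fin 0 (p x))// EFinM.
    exact: nnfun_muleindic_ge0.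
apply: eq_fsbigr => r _.
rewrite integralZl_indic_nnsfun//= integral_indic// setIT nuE//.
have [r0|r0] := ltP r 0%R.
  rewrite preimage_nnfun0// integral_set0 mule0 integral0_eq// => x _.
  by rewrite indic0 mulr0 mul0e.
under [RHS]eq_integral do rewrite EFinM -muleA.
rewrite ge0_integralZl//; last 2 first.
  - apply: emeasurable_funM => //; exact/measurable_EFinP.
  - by move=> x _; rewrite mule_ge0 ?lee_fin.
congr (_ * _); rewrite integral_mkcond; apply: eq_integral => x _.
by rewrite patchE indicE; case: ifP => _; rewrite ?mul1e ?mul0e.
Qed.

End density.

Section mrestr.
Local Open Scope ereal_scope.
Context d (T : measurableType d) (R : realType).
Variables (mu : {measure set T -> \bar R}) (D : set T) (mD : measurable D).

(** The restriction of [mu] to [D] has the density [\1_D]. *)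
Lemma ge0_integral_mrestr (f : T -> \bar R) :
  measurable_fun setT f -> (forall x, 0 <= f x) ->
  \int[mrestr mu mD]_x f x = \int[mu]_(x in D) f x.
Proof.
move=> mf f0; rewrite (@ge0_integral_density _ _ _ mu _ (\1_D))//.
  rewrite [RHS]integral_mkcond; apply: eq_integral => x _.
  by rewrite patchE indicE; case: ifP => _; rewrite ?mule1 ?mule0.
by move=> A mA; rewrite integral_indic// setIC.
Qed.

Lemma integral_mrestr (f : T -> \bar R) : measurable_fun setT f ->
  \int[mrestr mu mD]_x f x = \int[mu]_(x in D) f x.
Proof.
move=> mf; rewrite (integralE (mrestr mu mD)) (integralE mu) !ge0_integral_mrestr//.
  exact: measurable_funeneg.
exact: measurable_funepos.
Qed.

End mrestr.

(** [mu] need not be a probability, so that [mu] can be the restriction of a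
    probability to an event which is independent of the pair [(Z1, Z2)]; the
    constant [c] is then the probability of that event. *)
Section product_law.
Local Open Scope ereal_scope.
Context d d1 d2 (T : measurableType d) (U1 : measurableType d1)
  (U2 : measurableType d2) (R : realType).
Variables (mu : {measure set T -> \bar R}) (Z1 : {mfun T >-> U1})
  (Z2 : {mfun T >-> U2}).
Variables (nu1 : {finite_measure set U1 -> \bar R})
  (nu2 : {finite_measure set U2 -> \bar R}) (c : {nonneg R}).
Hypothesis muE : forall A B, measurable A -> measurable B ->
  mu (Z1 @^-1` A `&` Z2 @^-1` B) = c%:num%:E * (nu1 A * nu2 B).

Lemma integral_mscale (f : U1 -> \bar R) : nu1.-integrable setT f ->
  \int[mscale c nu1]_x f x = c%:num%:E * \int[nu1]_x f x.
Proof.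
move=> fi; have mf := measurable_int _ fi.
rewrite (integralE (mscale c nu1)) (integralE nu1) !ge0_integral_mscale//.
- by rewrite [RHS]muleBr//; exact: integrable_add_def.
- exact: measurable_funeneg.
- exact: measurable_funepos.
Qed.

Lemma integrable_mscale (f : U1 -> \bar R) : nu1.-integrable setT f ->
  (mscale c nu1).-integrable setT f.
Proof.
move=> /integrableP[mf flt]; apply/integrableP; split => //.
rewrite ge0_integral_mscale//; first exact: lte_mul_pinfty.
exact: measurableT_comp.
Qed.

(** By uniqueness of the product measure, the image of [mu] under [(Z1, Z2)] is
    the product of [c nu1] and [nu2]; then Fubini. *)
Lemma integral_product_law (f : U1 -> R) (g : U2 -> R) :
  nu1.-integrable setT (EFin \o f) -> nu2.-integrable setT (EFin \o g) ->
  mu.-integrable setT (fun w => (f (Z1 w) * g (Z2 w))%:E) ->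
  \int[mu]_w (f (Z1 w) * g (Z2 w))%:E =
  c%:num%:E * (\int[nu1]_x (f x)%:E * \int[nu2]_y (g y)%:E).
Proof.
move=> fi gi fgi.
have mf : measurable_fun setT f by exact/measurable_EFinP/(measurable_int _ fi).
have mg : measurable_fun setT g by exact/measurable_EFinP/(measurable_int _ gi).
have mZ : measurable_fun setT (fun w => (Z1 w, Z2 w)) by exact: measurable_fun_pair.
pose Z12 : {mfun T >-> (U1 * U2)%type} := HB.pack (fun w => (Z1 w, Z2 w))
  (isMeasurableFun.Build _ _ _ _ _ mZ).
pose h (z : U1 * U2) := (f z.1 * g z.2)%:E.
have mh : measurable_fun setT h.
  apply/measurable_EFinP/measurable_funM.
    exact: (measurableT_comp mf).
  exact: (measurableT_comp mg).
have pushE A : measurable A -> (mscale c nu1 \x nu2) A = pushforward mu Z12 A.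
  apply: product_measure_unique => B C mB mC.
  by rewrite -muleA -muE.
have hi : (mscale c nu1 \x nu2).-integrable setT h.
  have := @integrable_pushforward _ _ _ _ R Z12 mZ mu setT h mh fgi measurableT.
  move=> /integrableP[_ hlt]; apply/integrableP; split => //.
  by rewrite (eq_measure_integral (pushforward mu Z12))// => A mA _; exact: pushE.
transitivity (\int[pushforward mu Z12]_z h z).
  by rewrite (@integral_pushforward _ _ _ _ R Z12 mZ mu setT h mh fgi measurableT).
rewrite -(eq_measure_integral _ (fun A mA _ => pushE A mA)).
rewrite -(integral12_prod_meas1 hi) /fubini_F /h /=.
under eq_integral do (under eq_integral do rewrite EFinM; rewrite integralZl//).
have gfin : \int[nu2]_y (g y)%:E \is a fin_num by exact: integrable_fin_num.
rewrite -(fineK gfin) integralZr//; last exact: integrable_mscale.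
by rewrite integral_mscale// muleA.
exact: mZ.
Qed.
End product_law.

(** * Risk of a locally weighted average, given finitely many cells *)

Lemma integral_label_partition d (T : measurableType d) (R : realType)
    (mu : {measure set T -> \bar R}) (I : finType) (label : T -> I)
    (Q : pred I) (f : T -> R) :
    (forall i, measurable (label @^-1` [set i])) -> measurable_fun setT f ->
  (\int[mu]_(w in [set w | Q (label w)]) (f w)%:E =
  \sum_(i | Q i) \int[mu]_(w in label @^-1` [set i]) (f w)%:E)%E.
Proof.
move=> mlabel mf; pose s := [seq i <- index_enum I | Q i].
have E : [set w | Q (label w)] = \big[setU/set0]_(i <- s) (label @^-1` [set i]).
  rewrite -bigcup_seq; apply/seteqP; split => [w /= Qw|w [i /=]].
    by exists (label w) => //=; rewrite mem_filter Qw mem_index_enum.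
  by rewrite mem_filter => /andP[Qi _] ->.
rewrite E -[in RHS]big_filter -/s; apply: integral_bigsetU_EFin => //.
- by rewrite filter_uniq// index_enum_uniq.
- apply/trivIsetP => i j _ _ ij; rewrite -subset0 => w [/= wi wj].
  by move: ij; rewrite -wi -wj eqxx.
- by apply/measurable_EFinP; exact: measurable_funTS.
Qed.

Lemma measurable_fun_label d (T : measurableType d) (R : realType) (I : finType)
    (label : T -> I) (g : I -> R) :
  (forall i, measurable (label @^-1` [set i])) ->
  measurable_fun setT (fun w => g (label w)).
Proof.
move=> mlabel _ A mA; rewrite setTI.
have -> : (fun w => g (label w)) @^-1` A =
    \bigcup_(i in [set i | A (g i)]) (label @^-1` [set i]).
  by apply/seteqP; split => [w /= Aw|w [i /= Ai ->]//]; exists (label w).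
by apply: fin_bigcup_measurable.
Qed.

(** [Z] is a sample of independent copies of [Z0], and [G] sends an observation
    to its cell in a finite measurable partition. *)
Section sample.
Local Open Scope ereal_scope.
Context d1 (T : measurableType d1) (R : realType) (P : probability T R)
  d2 (U : measurableType d2).
Variables (Z0 : {mfun T >-> U}) (Z : nat -> {mfun T >-> U}).
Hypothesis Z_indep : mutually_independent P (fun i => Z i : T -> U).
Hypothesis Z_law : forall i, has_law P (Z i) (pushforward P Z0).
Variables (F : finType) (G : U -> F).
Hypothesis mG : forall a, measurable (G @^-1` [set a]).
Variable n : nat.

(** The independence hypothesis is about sequences of sets indexed by [nat]; it
    is used with the sets [B l] completed by [setT] beyond [n]. *)
Lemma prob_sample (B : 'I_n -> set U) : (forall l, measurable (B l)) ->
  P [set w | forall l : 'I_n, B l (Z l w)] = \prod_l P (Z0 @^-1` B l).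
Proof.
move=> mB; pose A i := if insub i is Some l then B l else setT.
have mA i : measurable (A i) by rewrite /A; case: insubP => [l _ _|_].
have := Z_indep (iota_uniq 0 (n - 0)) mA.
rewrite -/(index_iota 0 n) big_mkord.
have -> : \bigcap_(i in [set` index_iota 0 n]) (Z i @^-1` A i) =
    [set w | forall l : 'I_n, B l (Z l w)].
  apply/seteqP; split => w /= Hw.
    move=> l; have := Hw l; rewrite /= mem_index_iota ltn_ord => /(_ isT).
    by rewrite /A /= valK.
  move=> i /=; rewrite mem_index_iota /= => ilt.
  by rewrite /A insubT; exact: (Hw (Ordinal ilt)).
move=> ->; apply: eq_bigr => l _.
by rewrite Z_law//; rewrite /A valK.
Qed.

Definition cell_prob (a : F) : R := fine (P (Z0 @^-1` (G @^-1` [set a]))).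

Lemma measurable_Z0_cell a : measurable (Z0 @^-1` (G @^-1` [set a])).
Proof. exact: measurable_funPTI. Qed.

Lemma cell_probE a : P (Z0 @^-1` (G @^-1` [set a])) = (cell_prob a)%:E.
Proof. by rewrite fineK// fin_num_measure//; exact: measurable_Z0_cell. Qed.

Lemma cell_prob_ge0 a : (0 <= cell_prob a)%R.
Proof. exact: fine_ge0. Qed.

Definition sample_cell (alpha : {ffun 'I_n -> F}) : set T :=
  [set w | forall l : 'I_n, G (Z l w) = alpha l].

Lemma measurable_sample_cell alpha : measurable (sample_cell alpha).
Proof.
have -> : sample_cell alpha =
    \bigcap_(l : 'I_n) ((Z l) @^-1` (G @^-1` [set alpha l])).
  by apply/seteqP; split => w /= Hw l => [_|]; exact: Hw.
by apply: fin_bigcap_measurable => // l _; exact: measurable_funPTI.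
Qed.

Lemma prob_sample_cell alpha :
  P (sample_cell alpha) = (product_weight cell_prob alpha)%:E.
Proof.
rewrite (prob_sample (B := fun l => G @^-1` [set alpha l]))//.
by under eq_bigr do rewrite cell_probE; rewrite prodEFin.
Qed.

Definition cell_law (a : F) := mrestr (distribution P Z0) (mG a).

Lemma prob_sample_cell1 alpha (i : 'I_n) A : measurable A ->
  P (sample_cell alpha `&` Z i @^-1` A) =
  (\prod_(l | l != i) cell_prob (alpha l))%:E * cell_law (alpha i) A.
Proof.
move=> mA.
pose B l := G @^-1` [set alpha l] `&` (if l == i then A else setT).
have -> : sample_cell alpha `&` Z i @^-1` A = [set w | forall l : 'I_n, B l (Z l w)].
  apply/seteqP; split => w /=.
    by move=> [wa wA] l; rewrite /B; split; [exact: wa|case: eqP => // ->].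
  by move=> wB; split => [l|]; [have [] := wB l|have [] := wB i; rewrite eqxx].
rewrite prob_sample; last by move=> l; apply: measurableI => //; case: ifP.
rewrite (bigD1 i)//= muleC -prodEFin; congr (_ * _).
  apply: eq_bigr => l li; rewrite /B (negPf li) setIT; exact: cell_probE.
by rewrite /B eqxx /cell_law /mrestr /= setIC.
Qed.

Lemma prob_sample_cell2 alpha (i j : 'I_n) A B : i != j ->
  measurable A -> measurable B ->
  P (Z i @^-1` A `&` Z j @^-1` B `&` sample_cell alpha) =
  (\prod_(l | (l != i) && (l != j)) cell_prob (alpha l))%:E *
  (cell_law (alpha i) A * cell_law (alpha j) B).
Proof.
move=> ij mA mB; have ji : j != i by rewrite eq_sym.
pose C l := G @^-1` [set alpha l] `&`
  (if l == i then A else if l == j then B else setT).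
have -> : Z i @^-1` A `&` Z j @^-1` B `&` sample_cell alpha =
    [set w | forall l : 'I_n, C l (Z l w)].
  apply/seteqP; split => w /=.
    move=> [[wA wB] wa] l; rewrite /C; split; first exact: wa.
    by case: eqP => [->//|_]; case: eqP => // ->.
  move=> wC; split => [|l]; last by have [] := wC l.
  split; first by have [_] := wC i; rewrite eqxx.
  by have [_] := wC j; rewrite (negPf ji) eqxx.
rewrite prob_sample; last first.
  by move=> l; apply: measurableI => //; case: ifP => // _; case: ifP.
rewrite (bigD1 i)//= (bigD1 j)//= muleA muleC -prodEFin; congr (_ * _).
  apply: eq_bigr => l /andP[li lj].
  by rewrite /C (negPf li) (negPf lj) setIT; exact: cell_probE.
by rewrite /C eqxx (negPf ji) eqxx /cell_law /mrestr /= [in RHS]setIC [_ `&` B]setIC.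
Qed.

Lemma ge0_integral_cell_law a (f : U -> \bar R) : measurable_fun setT f ->
  (forall u, 0 <= f u) ->
  \int[cell_law a]_u f u = \int[P]_(w in Z0 @^-1` (G @^-1` [set a])) f (Z0 w).
Proof.
move=> mf f0; rewrite /cell_law ge0_integral_mrestr//.
rewrite ge0_integral_pushforward//; exact: measurable_funTS.
Qed.

Lemma integral_cell_law a (f : U -> \bar R) : measurable_fun setT f ->
  P.-integrable setT (f \o Z0) ->
  \int[cell_law a]_u f u = \int[P]_(w in Z0 @^-1` (G @^-1` [set a])) f (Z0 w).
Proof.
move=> mf fi; rewrite /cell_law integral_mrestr//.
rewrite integral_pushforward//.
by apply: integrableS fi => //; exact: measurable_Z0_cell.
Qed.

(** Given the cells of the sample, the law of [Z i] depends only on its own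
    cell. *)
Lemma ge0_integral_sample_cell alpha (i : 'I_n) (f : U -> \bar R) :
  measurable_fun setT f -> (forall u, 0 <= f u) ->
  \int[P]_(w in sample_cell alpha) f (Z i w) =
  (\prod_(l | l != i) cell_prob (alpha l))%:E *
  \int[P]_(w in Z0 @^-1` (G @^-1` [set alpha i])) f (Z0 w).
Proof.
move=> mf f0.
rewrite -(ge0_integral_mrestr P (measurable_sample_cell alpha))//; last first.
  exact: measurableT_comp.
pose mu := mrestr P (measurable_sample_cell alpha).
transitivity (\int[pushforward mu (Z i)]_u f u).
  by rewrite ge0_integral_pushforward.
have c0 : (0 <= \prod_(l | l != i) cell_prob (alpha l))%R.
  by apply: prodr_ge0 => l _; exact: cell_prob_ge0.
rewrite -ge0_integral_cell_law//.
rewrite (eq_measure_integral (mscale (NngNum c0) (cell_law (alpha i)))).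
  by rewrite ge0_integral_mscale.
move=> A mA _; rewrite /= /pushforward /mu /mrestr setIC.
exact: prob_sample_cell1.
Qed.

Section products.
Variable V : U -> R.
Hypothesis mV : measurable_fun setT V.
Hypothesis V2 : P.-integrable setT (fun w => (V (Z0 w) ^+ 2)%:E).

Lemma integrable_V : P.-integrable setT (fun w => (V (Z0 w))%:E).
Proof. by apply: integrable_of_sqr V2; exact: measurableT_comp. Qed.

Lemma integrable_sqr_sample i : P.-integrable setT (fun w => (V (Z i w) ^+ 2)%:E).
Proof.
have mV2 : measurable_fun setT (fun u => (V u ^+ 2)%:E).
  by apply/measurable_EFinP; exact: measurable_funX.
apply/integrableP; split; first by apply: (measurableT_comp mV2).
move/integrableP : V2 => [_]; apply: le_lt_trans.
under eq_integral do rewrite gee0_abs ?lee_fin ?sqr_ge0//.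
under [leRHS]eq_integral do rewrite gee0_abs ?lee_fin ?sqr_ge0//.
have := @ge0_integral_pushforward _ _ _ _ R (Z i) _ P setT _ measurableT mV2.
rewrite preimage_setT => <-//; last by move=> u _; rewrite lee_fin sqr_ge0.
have := @ge0_integral_pushforward _ _ _ _ R Z0 _ P setT _ measurableT mV2.
rewrite preimage_setT => <-//; last by move=> u _; rewrite lee_fin sqr_ge0.
rewrite (eq_measure_integral (pushforward P Z0))// => A mA _.
exact: Z_law.
Qed.

Lemma integrable_mul_sample i j :
  P.-integrable setT (fun w => (V (Z i w) * V (Z j w))%:E).
Proof.
have H : P.-integrable setT (fun w => (V (Z i w) ^+ 2 + V (Z j w) ^+ 2)%:E).
  by under eq_fun do rewrite EFinD; apply: integrableD => //; exact: integrable_sqr_sample.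
apply: le_integrable H => //.
  by apply/measurable_EFinP; apply: measurable_funM; exact: measurableT_comp.
move=> w _ /=; rewrite lee_fin [leRHS]ger0_norm ?addr_ge0 ?sqr_ge0//.
set x := V _; set y := V _.
rewrite ler_norml; apply/andP; split; have := sqr_ge0 (x + y)%R; have := sqr_ge0 (x - y)%R; nra.
Qed.

(** Given the cells of the sample, two distinct observations are independent. *)
Lemma integral_mul_sample_cell alpha (i j : 'I_n) : i != j ->
  \int[P]_(w in sample_cell alpha) (V (Z i w) * V (Z j w))%:E =
  (\prod_(l | (l != i) && (l != j)) cell_prob (alpha l))%:E *
  (\int[P]_(w in Z0 @^-1` (G @^-1` [set alpha i])) (V (Z0 w))%:E *
   \int[P]_(w in Z0 @^-1` (G @^-1` [set alpha j])) (V (Z0 w))%:E).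
Proof.
move=> ij; pose mu := mrestr P (measurable_sample_cell alpha).
have mEV : measurable_fun setT (EFin \o V) by exact/measurable_EFinP.
have c0 : (0 <= \prod_(l | (l != i) && (l != j)) cell_prob (alpha l))%R.
  by apply: prodr_ge0 => l _; exact: cell_prob_ge0.
have mVV : measurable_fun setT (fun w => (V (Z i w) * V (Z j w))%:E).
  by apply/measurable_EFinP; apply: measurable_funM; exact: measurableT_comp.
rewrite -(integral_mrestr P (measurable_sample_cell alpha))// -/mu.
rewrite -(@integral_cell_law (alpha i) _ mEV integrable_V).
rewrite -(@integral_cell_law (alpha j) _ mEV integrable_V).
have Vi a : (cell_law a).-integrable setT (EFin \o V).
  apply/integrableP; split => //.
  rewrite ge0_integral_cell_law//; last exact: measurableT_comp.
  have /integrableP[_] := integrable_V; apply: le_lt_trans.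
  apply: ge0_subset_integral => //; first exact: measurable_Z0_cell.
  by apply: measurableT_comp => //; apply: (measurableT_comp mEV).
apply: (@integral_product_law _ _ _ _ _ _ _ mu (Z i) (Z j)
  (cell_law (alpha i)) (cell_law (alpha j)) (NngNum c0)) => //.
- by move=> A B mA mB; exact: prob_sample_cell2.
- exact: Vi.
- exact: Vi.
apply/integrableP; split => //.
rewrite ge0_integral_mrestr//; last exact: measurableT_comp.
have /integrableP[_] := integrable_mul_sample i j; apply: le_lt_trans.
apply: ge0_subset_integral => //; first exact: measurable_sample_cell.
exact: measurableT_comp.
Qed.

(** By [V_mean], [b a] is the conditional mean of [V] given the cell [a]; on a
    cell of probability zero it is only required to be bounded by [B]. *)
Section risk.
Local Open Scope ring_scope.
Variables (kappa b : F -> R) (B Q c : R).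
Hypothesis kappa_ge0 : forall a, 0 <= kappa a.
Hypothesis kappa_le1 : forall a, kappa a <= 1.
Hypothesis B_ge0 : 0 <= B.
Hypothesis Q_ge0 : 0 <= Q.
Hypothesis b_le : forall a, `|b a| <= B.
Hypothesis V_mean : forall a,
  (\int[P]_(w in Z0 @^-1` (G @^-1` [set a])) (V (Z0 w))%:E =
   (b a * cell_prob a)%:E)%E.
Hypothesis V_sqr : forall a,
  (\int[P]_(w in Z0 @^-1` (G @^-1` [set a])) (V (Z0 w) ^+ 2)%:E <=
   (Q * cell_prob a)%:E)%E.

(** When the total weight vanishes, the quotient is zero and the second term
    makes the error equal to [c]; for the forest estimator at [x], which is then
    zero, [c] is [- m x]. *)
Definition partition_error (w : T) : R :=
  (\sum_(i < n) V (Z i w) * kappa (G (Z i w))) / (\sum_(i < n) kappa (G (Z i w)))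
  + c * (\sum_(i < n) kappa (G (Z i w)) == 0)%:R.

Lemma partition_error_cell alpha w : sample_cell alpha w ->
  partition_error w ^+ 2 =
  \sum_i \sum_j (weight kappa alpha i * weight kappa alpha j) * (V (Z i w) * V (Z j w))
  + c ^+ 2 * (total_weight kappa alpha == 0)%:R.
Proof.
move=> wa; rewrite /partition_error.
have -> : \sum_(i < n) kappa (G (Z i w)) = total_weight kappa alpha.
  by apply: eq_bigr => i _; rewrite wa.
have -> : \sum_i \sum_j (weight kappa alpha i * weight kappa alpha j) *
    (V (Z i w) * V (Z j w)) =
    ((\sum_(i < n) V (Z i w) * kappa (G (Z i w))) / total_weight kappa alpha) ^+ 2.
  rewrite expr2 [_ / _]mulr_suml mulr_suml; apply: eq_bigr => i _.
  rewrite mulr_sumr; apply: eq_bigr => j _; rewrite /weight !wa; ring.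
have [->|] := eqVneq; last by rewrite !mulr0 !addr0.
by rewrite invr0 mulr0 !mulr1 expr0n !add0r.
Qed.

Lemma prod_split2 (alpha : {ffun 'I_n -> F}) (i j : 'I_n) : i != j ->
  \prod_(l | (l != i) && (l != j)) cell_prob (alpha l) *
    (b (alpha i) * cell_prob (alpha i) * (b (alpha j) * cell_prob (alpha j))) =
  product_weight cell_prob alpha * (b (alpha i) * b (alpha j)).
Proof.
move=> ij; rewrite /product_weight [in RHS](bigD1 i)//= [in RHS](bigD1 j) 1?eq_sym//=; ring.
Qed.

(** On a sample cell the weights are constants. The products of distinct
    observations integrate to the products of conditional means, and the
    squares are bounded by [Q]; adding the nonnegative diagonal terms
    [(w_i b_i)^2] completes the square [(sum w_i b_i)^2]. *)
Lemma integral_sqr_error_cell_le alpha :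
  (\int[P]_(w in sample_cell alpha) (partition_error w ^+ 2)%:E <=
   (product_weight cell_prob alpha *
     ((\sum_i weight kappa alpha i * b (alpha i)) ^+ 2 +
      Q * (\sum_i weight kappa alpha i ^+ 2) +
      c ^+ 2 * (total_weight kappa alpha == 0)%:R))%:E)%E.
Proof.
have mcell := measurable_sample_cell alpha.
pose VV i j w := V (Z i w) * V (Z j w).
pose wt := weight kappa alpha.
have VVi (i j : 'I_n) : P.-integrable (sample_cell alpha) (fun w => (VV i j w)%:E).
  by apply: integrableS (integrable_mul_sample i j).
have wVVi (i j : 'I_n) : P.-integrable (sample_cell alpha)
    (fun w => (wt i * wt j * VV i j w)%:E).
  under eq_fun do rewrite EFinM; exact: integrableZl.
have swVVi (i : 'I_n) : P.-integrable (sample_cell alpha)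
    (fun w => (\sum_j (wt i * wt j * VV i j w)%:E)%E).
  exact: integrable_sum.
rewrite (eq_integral (fun w => (\sum_i \sum_j (wt i * wt j * VV i j w)%:E +
    (c ^+ 2 * (total_weight kappa alpha == 0)%:R)%:E)%E)); last first.
  move=> w; rewrite inE => wa; rewrite (partition_error_cell wa) EFinD -sumEFin.
  by congr (_ + _)%E; apply: eq_bigr => i _; rewrite -sumEFin.
rewrite integralD//; last 2 first.
  exact: integrable_sum.
  exact: finite_measure_integrable_cst.
rewrite integral_cst// [X in (_ + _ * X <= _)%E](prob_sample_cell alpha) integral_sum//.
have IVV (i j : 'I_n) : (\int[P]_(w in sample_cell alpha) (wt i * wt j * VV i j w)%:E <=
    (wt i * wt j * (product_weight cell_prob alpha *
      (if i == j then Q else b (alpha i) * b (alpha j))))%:E)%E.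
  under eq_integral do rewrite EFinM.
  rewrite integralZl// [leRHS]EFinM; apply: lee_wpmul2l.
    by rewrite lee_fin mulr_ge0// weight_ge0.
  have [<-|ij] := eqVneq i j; last first.
    by rewrite /VV integral_mul_sample_cell// !V_mean -!EFinM prod_split2.
  rewrite (eq_integral (fun w => (V (Z i w) ^+ 2)%:E)); last first.
    by move=> w _; rewrite expr2.
  rewrite (@ge0_integral_sample_cell alpha i (fun u => (V u ^+ 2)%:E)); last 2 first.
    by apply/measurable_EFinP; exact: measurable_funX.
    by move=> u; rewrite lee_fin sqr_ge0.
  apply: (@le_trans _ _ ((\prod_(l | l != i) cell_prob (alpha l))%:E *
      (Q * cell_prob (alpha i))%:E)%E).
    by apply: lee_wpmul2l => //; rewrite lee_fin prodr_ge0// => l _; exact: cell_prob_ge0.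
  rewrite -EFinM lee_fin /product_weight [in leRHS](bigD1 i)//= mulrCA mulrC.
  by rewrite [cell_prob _ * _]mulrC.
apply: (@le_trans _ _ ((\sum_i \sum_j wt i * wt j * (product_weight cell_prob alpha *
      (if i == j then Q else b (alpha i) * b (alpha j)))) +
    c ^+ 2 * (total_weight kappa alpha == 0)%:R * product_weight cell_prob alpha)%:E).
  rewrite EFinD EFinM leeD2r// -sumEFin; apply: lee_sum => i _.
  by rewrite integral_sum// -sumEFin; apply: lee_sum => j _.
rewrite lee_fin mulrDr [X in _ <= _ + X]mulrC lerD2r.
have pw0 : 0 <= product_weight cell_prob alpha by apply/product_weight_ge0/cell_prob_ge0.
have -> : (\sum_i wt i * b (alpha i)) ^+ 2 =
    \sum_i \sum_j wt i * wt j * (b (alpha i) * b (alpha j)).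
  rewrite expr2 mulr_suml; apply: eq_bigr => i _; rewrite mulr_sumr.
  by apply: eq_bigr => j _; ring.
rewrite mulr_sumr -big_split mulr_sumr; apply: ler_sum => i _ /=.
rewrite (bigD1 i)//= eqxx [in leRHS](bigD1 i)//=.
have -> : \sum_(j | j != i) wt i * wt j * (product_weight cell_prob alpha *
    (if i == j then Q else b (alpha i) * b (alpha j))) =
    product_weight cell_prob alpha *
    (\sum_(j | j != i) wt i * wt j * (b (alpha i) * b (alpha j))).
  rewrite mulr_sumr; apply: eq_bigr => j ji.
  by rewrite eq_sym (negPf ji); ring.
have := mulr_ge0 pw0 (sqr_ge0 (wt i * b (alpha i))).
rewrite /wt; lra.
Qed.

(** The sample cells form a finite partition of the probability space, so the
    risk is the sum of the contributions of [integral_sqr_error_cell_le]. *)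
Lemma partition_risk_le (q := mean cell_prob kappa) : (0 < n)%N -> 0 < q ->
  (\int[P]_w (partition_error w ^+ 2)%:E <=
   ((4 * B ^+ 2 + 4 * Q + c ^+ 2) / (n%:R * q) +
    2 * (mean cell_prob (fun a => kappa a * b a) / q) ^+ 2)%:E)%E.
Proof.
move=> n0 q0.
pose label w := [ffun l : 'I_n => G (Z l w)].
have labelE alpha : label @^-1` [set alpha] = sample_cell alpha.
  apply/seteqP; split => w /=; first by move=> <- l; rewrite ffunE.
  by move=> wa; apply/ffunP => l; rewrite ffunE wa.
have mlabel alpha : measurable (label @^-1` [set alpha]).
  by rewrite labelE; exact: measurable_sample_cell.
have merr : measurable_fun setT partition_error.
  have kE w : \sum_(i < n) kappa (G (Z i w)) = total_weight kappa (label w).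
    by apply: eq_bigr => i _; rewrite ffunE.
  rewrite /partition_error; apply: measurable_funD.
    apply: measurable_funM.
      apply: measurable_sum => i; apply: measurable_funM.
        exact: measurableT_comp.
      exact: (measurableT_comp (measurable_fun_label kappa mG)).
    under eq_fun do rewrite kE.
    exact: (measurable_fun_label (fun alpha => (total_weight kappa alpha)^-1) mlabel).
  under eq_fun do rewrite kE.
  exact: (measurable_fun_label (fun alpha => c * (total_weight kappa alpha == 0)%:R) mlabel).
have merr2 : measurable_fun setT (fun w => partition_error w ^+ 2).
  exact: measurable_funX.
have -> : [set: T] = [set w | xpredT (label w)] by apply/seteqP; split.
rewrite (integral_label_partition P xpredT mlabel merr2).
have p1 : \sum_a cell_prob a = 1.
  have mZG a : measurable ((G \o Z0) @^-1` [set a]) by exact: measurable_Z0_cell.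
  have := @integral_label_partition _ _ _ P _ _ xpredT (fun=> 1) mZG (measurable_cst _).
  have -> : [set w | xpredT ((G \o Z0) w)] = [set: T] by apply/seteqP; split.
  rewrite integral_cst// mul1e => E; apply: EFin_inj.
  apply: (etrans _ (probability_setT P)).
  rewrite [X in _ = X]E -sumEFin; apply: eq_bigr => a _.
  by rewrite integral_cst// mul1e; exact/esym/cell_probE.
apply: le_trans (_ : _ <= (\sum_(alpha : {ffun 'I_n -> F}) product_weight cell_prob alpha *
     ((\sum_i weight kappa alpha i * b (alpha i)) ^+ 2 +
      Q * (\sum_i weight kappa alpha i ^+ 2) +
      c ^+ 2 * (total_weight kappa alpha == 0)%:R))%:E)%E _.
  rewrite -sumEFin; apply: lee_sum => alpha _.
  by rewrite labelE; exact: integral_sqr_error_cell_le.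
rewrite lee_fin; apply: discrete_risk_le => //; exact: cell_prob_ge0.
Qed.
End risk.
End products.
End sample.

(** * Dyadic intervals and the uniform distribution *)

Section dyadic.
Variable R : realType.
Implicit Types (t u : R) (c : nat) (v : int).

Lemma exp2_gt0 c : 0 < 2 ^+ c :> R.
Proof. by rewrite exprn_gt0. Qed.

(** At [t = 0] the lower bound is an equality, because [0] is attached to the
    first interval. *)
Lemma dyadic_index_bounds c t :
  (dyadic_index c t - 1)%:~R <= 2 ^+ c * t <= (dyadic_index c t)%:~R.
Proof.
rewrite /dyadic_index; case: eqP => [->|_]; first by rewrite subrr lexx ler01.
by rewrite ceil_ge andbT ltW// gt_pred_ceil// num_real.
Qed.

Lemma dyadic_index_eq c t v : 1 <= v ->
  (v - 1)%:~R < 2 ^+ c * t <= v%:~R -> dyadic_index c t = v.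
Proof.
move=> v1 tv; rewrite /dyadic_index; case: eqP => [t0|_]; last exact/ceil_def.
by move: tv; rewrite t0 ltrz0 subr_lt0 ltNge v1.
Qed.

Lemma dyadic_index_dist c t u : dyadic_index c t = dyadic_index c u ->
  `|t - u| <= 2^-1 ^+ c.
Proof.
move=> tu; have := dyadic_index_bounds c t; have := dyadic_index_bounds c u.
rewrite tu intrB; set v := _%:~R => /andP[u1 u2] /andP[t1 t2].
rewrite exprVn -[leRHS]mul1r ler_pdivlMr ?exp2_gt0// mulrC.
rewrite -[X in X * _]gtr0_norm ?exp2_gt0// -normrM ler_norml mulrBr; lra.
Qed.

Lemma dyadic_index_range c t : 0 <= t <= 1 -> 1 <= dyadic_index c t <= (2 ^ c)%:Z.
Proof.
move=> /andP[t0 t1]; rewrite /dyadic_index; case: eqP => [_|/eqP t0'].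
  by rewrite lexx lez_nat expn_gt0.
rewrite -gtz0_ge1 ceil_gt0 lt_neqAle eq_sym t0' (mulr_ge0 (ltW (exp2_gt0 c)))//=.
by rewrite ceil_le_int -pmulrn natrX ler_piMr// ltW// exp2_gt0.
Qed.

Lemma measurable_dyadic_index c v : measurable [set t : R | dyadic_index c t = v].
Proof.
have mf : measurable_fun setT (fun t : R => 2 ^+ c * t) by exact: measurable_funM.
have -> : [set t : R | dyadic_index c t = v] =
    ([set _ | v = 1] `&` (fun t : R => 2 ^+ c * t) @^-1` [set 0]) `|`
    ((fun t : R => 2 ^+ c * t) @^-1` ([set~ 0] `&` `](v - 1)%:~R, v%:~R]%classic)).
  apply/seteqP; split => t /=; rewrite /dyadic_index in_itv /=.
    case: eqP => [t0 <-|t0 <-]; [by left|right; split=> //].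
    by rewrite ceil_ge andbT gt_pred_ceil// num_real.
  by case: eqP => [t0 [[]|[]]//|t0 [[]//|[_ /ceil_def]]].
have mp A : measurable A -> measurable ((fun t : R => 2 ^+ c * t) @^-1` A).
  by move=> mA; rewrite -[X in measurable X]setTI; exact: mf.
apply: measurableU; last by apply: mp; apply: measurableI => //; exact: measurableC.
apply: measurableI; last exact: mp.
have [v1|v1] := pselect (v = 1).
  by rewrite (_ : [set _ | _] = setT)//; apply/seteqP; split.
by rewrite (_ : [set _ | _] = set0)//; apply/seteqP; split.
Qed.

Lemma uniform_prob01E (A : set R) : measurable A ->
  uniform_prob (@ltr01 R) A = lebesgue_measure (A `&` `[0, 1]%classic).
Proof.
move=> mA; rewrite /uniform_prob integral_uniform_pdf.
rewrite (eq_integral (fun=> 1%E)) ?integral_cst ?mul1e//; first exact: measurableI.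
by move=> x; rewrite inE => -[_ /=]; rewrite in_itv /= /uniform_pdf => ->; rewrite subr0 invr1.
Qed.

(** The cell lies between a half-open and a closed interval with the same end
    points, whether or not it contains [0]. *)
Lemma uniform_dyadic_cell c u : 0 <= u <= 1 ->
  uniform_prob (@ltr01 R) [set t | dyadic_index c t = dyadic_index c u] =
  (2^-1 ^+ c)%:E.
Proof.
move=> /(dyadic_index_range c); set v := dyadic_index c u => /andP[v1 vc].
have mD := measurable_dyadic_index c v.
have v0 : 0 <= (v - 1)%:~R / 2 ^+ c :> R.
  by rewrite divr_ge0 ?ler0z ?subr_ge0// ltW// exp2_gt0.
have v1' : v%:~R / 2 ^+ c <= 1 :> R.
  by rewrite ler_pdivrMr ?exp2_gt0// mul1r -natrX pmulrn ler_int.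
have vv : (v - 1)%:~R / 2 ^+ c < v%:~R / 2 ^+ c :> R.
  by rewrite ltr_pM2r ?invr_gt0 ?exp2_gt0// ltr_int ltrBlDr ltrDl.
have len : v%:~R / 2 ^+ c - (v - 1)%:~R / 2 ^+ c = 2^-1 ^+ c :> R.
  by rewrite -mulrBl intrB opprB addrCA subrr addr0 mul1r exprVn.
rewrite uniform_prob01E//; apply/le_anti/andP; split.
  apply: (@le_trans _ _ (lebesgue_measure
      `[(v - 1)%:~R / 2 ^+ c, v%:~R / 2 ^+ c]%classic)).
    apply: le_measure; rewrite ?inE//; first exact: measurableI.
    move=> t [/= tv _]; rewrite in_itv /= ler_pdivrMr ?exp2_gt0//.
    rewrite ler_pdivlMr ?exp2_gt0// mulrC -tv; exact: dyadic_index_bounds.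
  by rewrite lebesgue_measure_itv/= lte_fin vv -EFinD len.
apply: (@le_trans _ _ (lebesgue_measure
    `](v - 1)%:~R / 2 ^+ c, v%:~R / 2 ^+ c]%classic)).
  by rewrite lebesgue_measure_itv/= lte_fin vv -EFinD len.
apply: le_measure; rewrite ?inE//; first exact: measurableI.
move=> t; rewrite /= in_itv /= => /andP[t1 t2]; split => /=.
  apply: dyadic_index_eq => //.
  by move: t1 t2; rewrite ltr_pdivrMr ?exp2_gt0// ler_pdivlMr ?exp2_gt0// mulrC => -> ->.
by rewrite in_itv /= (le_trans v0 (ltW t1)) (le_trans t2 v1').
Qed.

End dyadic.

Section cube.
Variable R : realType.

Lemma measurable_box d (A : 'I_d -> set R) : (forall j, measurable (A j)) ->
  measurable [set z : d.-tuple R | forall j, A j (tnth z j)].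
Proof.
move=> mA.
have -> : [set z : d.-tuple R | forall j, A j (tnth z j)] =
    \bigcap_(j : 'I_d) ((fun z => tnth z j) @^-1` A j).
  by apply/seteqP; split => z /= Az j => [_|]; exact: Az.
apply: fin_bigcap_measurable => // j _.
by rewrite -[X in measurable X]setTI; exact: measurable_tnth.
Qed.

Lemma uniform_cube_box d (A : 'I_d -> set R) : (forall j, measurable (A j)) ->
  uniform_cube R d [set z | forall j, A j (tnth z j)] =
  (\prod_j uniform_prob (@ltr01 R) (A j))%E.
Proof.
elim: d A => [|d IH] A mA.
  by rewrite big_ord0 /= diracE mem_set//= => -[].
rewrite big_ord_recl /= /distribution /pushforward.
have -> : cons_pair (R:=R) (d:=d) @^-1` [set z | forall j, A j (tnth z j)] =
    A ord0 `*` [set z | forall j, A (lift ord0 j) (tnth z j)].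
  apply/seteqP; split => -[t z] /=.
    move=> Az; split; first exact: (Az ord0).
    by move=> j; have := Az (lift ord0 j); rewrite tnthS.
  move=> [At Az] j; have [->|j0] := eqVneq j ord0; first exact: At.
  have [i -> _] : exists2 i, j = lift ord0 i & True.
    by case: (unliftP ord0 j) j0 => [i ->|->]; [exists i|rewrite eqxx].
  by rewrite tnthS; exact: Az.
rewrite product_measure1E; first last.
- apply: (@measurable_box d (fun j => A (lift ord0 j))) => j; exact: mA.
- exact: (mA ord0).
congr (_ * _)%E; apply: (IH (fun j => A (lift ord0 j))) => j; exact: mA.
Qed.

Lemma uniform_cube_unit_cube d : uniform_cube R d (@unit_cube R d) = 1%E.
Proof.
have -> : @unit_cube R d = [set z | forall j, `[0, 1]%classic (tnth z j)].
  by apply/seteqP; split => z /= zc j; have := zc j; rewrite /= in_itv.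
apply: etrans (@uniform_cube_box d (fun=> `[0, 1]%classic) _) _ => //.
rewrite big1// => j _.
by rewrite /uniform_prob integral_uniform_pdf1.
Qed.

End cube.

(** * Moments of the Gaussian noise *)

Section gaussian.
Variable R : realType.
Local Notation mu := (@lebesgue_measure R).

Lemma normal_pdfN (s x : R) : s != 0 ->
  normal_pdf 0 s (- x) = normal_pdf 0 s x.
Proof. by move=> s0; rewrite !normal_pdfE// /normal_fun !subr0 sqrrN. Qed.

Lemma normal_probN (s : R) (A : set R) : s != 0 -> measurable A ->
  normal_prob 0 s (-%R @^-1` A) = normal_prob 0 s A.
Proof.
move=> s0 mA; rewrite /normal_prob.
have mpdf : measurable_fun setT (fun x => (normal_pdf 0 s x)%:E).
  by apply/measurable_EFinP; exact: measurable_normal_pdf.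
transitivity (\int[pushforward mu (-%R : _ -> measurableTypeR R)]_(x in A) (normal_pdf 0 s x)%:E)%E.
  rewrite ge0_integral_pushforward//.
  - by apply: eq_integral => x _ /=; rewrite normal_pdfN.
  - exact: measurable_funTS.
  - by move=> x _; rewrite lee_fin normal_pdf_ge0.
by apply: eq_measure_integral => B mB _; exact: lebesgue_measureN.
Qed.

(** With [u = x^2 / (4 s^2)], [x^2 = 4 s^2 u <= 4 s^2 exp u]; multiplying the
    Gaussian weight [exp (- 2 u)] by [exp u] doubles the variance. The constant
    also corrects the ratio of the normalizations. *)
Lemma sqr_normal_pdf_le (s x : R) : s != 0 ->
  x ^+ 2 * normal_pdf 0 s x <=
  (4 * s ^+ 2 * normal_peak s / normal_peak (Num.sqrt 2 * s)) *
    normal_pdf 0 (Num.sqrt 2 * s) x.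
Proof.
move=> s0.
have s2 : Num.sqrt 2 * s != 0 by rewrite mulf_neq0// sqrtr_eq0 -ltNge.
have s20 : 0 < s ^+ 2 by rewrite exprn_even_gt0.
rewrite !normal_pdfE// /normal_fun !subr0.
have p1 := normal_peak_gt0 s0; have p2 := normal_peak_gt0 s2.
rewrite [leRHS]mulrA divfK ?(gt_eqF p2)// mulrCA [leRHS]mulrAC.
rewrite [leRHS]mulrC ler_pM2l//.
set u := x ^+ 2 / (4 * s ^+ 2).
have -> : - x ^+ 2 / (s ^+ 2 *+ 2) = - u - u by rewrite /u; field.
have -> : - x ^+ 2 / ((Num.sqrt 2 * s) ^+ 2 *+ 2) = - u.
  by rewrite exprMn sqr_sqrtr// /u; field.
rewrite expRD mulrA ler_pM2r ?expR_gt0// expRN ler_pdivrMr ?expR_gt0//.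
have -> : x ^+ 2 = 4 * s ^+ 2 * u by rewrite /u; field.
rewrite ler_pM2l ?(mulr_gt0 _ s20)//.
by apply: le_trans (expR_ge1Dx u); rewrite lerDr.
Qed.

(** The second moment is at most a multiple of the total mass of the Gaussian
    law of twice the variance. *)
Lemma normal_prob_sqr_lty (s : R) : s != 0 ->
  (\int[normal_prob 0 s]_x (x ^+ 2)%:E < +oo)%E.
Proof.
move=> s0.
have s2 : Num.sqrt 2 * s != 0 by rewrite mulf_neq0// sqrtr_eq0 -ltNge.
have mx2 : measurable_fun setT (fun x : R => (x ^+ 2)%:E).
  by apply/measurable_EFinP; exact: measurable_funX.
rewrite (@ge0_integral_density _ _ _ mu _ (normal_pdf 0 s))//; last 3 first.
- exact: measurable_normal_pdf.
- by move=> x; exact: normal_pdf_ge0.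
- by move=> x; rewrite lee_fin sqr_ge0.
pose K := 4 * s ^+ 2 * normal_peak s / normal_peak (Num.sqrt 2 * s).
apply: (@le_lt_trans _ _ (\int[mu]_x (K%:E * (normal_pdf 0 (Num.sqrt 2 * s) x)%:E))%E).
  apply: ge0_le_integral => //.
  - by move=> x _; rewrite -EFinM lee_fin mulr_ge0 ?sqr_ge0 ?normal_pdf_ge0.
  - apply: emeasurable_funM => //; apply/measurable_EFinP; exact: measurable_normal_pdf.
  - apply: emeasurable_funM => //; apply/measurable_EFinP; exact: measurable_normal_pdf.
  - by move=> x _; rewrite -!EFinM lee_fin; exact: sqr_normal_pdf_le.
rewrite integralZl//; last exact: integrable_normal_pdf.
by rewrite integral_normal_pdf mule1 ltry.
Qed.

(** [normal_prob] is a measure on [measurableTypeR R]; the identity transports it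
    to the default Borel structure of [R]. *)
Lemma measurable_to_real : measurable_fun setT (idfun : measurableTypeR R -> R).
Proof. by move=> _ A mA; rewrite setTI. Qed.

Definition to_real : {mfun measurableTypeR R >-> R} :=
  HB.pack (idfun : measurableTypeR R -> R)
    (isMeasurableFun.Build _ _ _ _ _ measurable_to_real).

(** The mean vanishes because the law is invariant under [-%R]. *)
Lemma gaussian_moments d (T : measurableType d) (P : probability T R)
    (eps : {RV P >-> R}) (s : R) : has_law P eps (centered_gaussian s) ->
  P.-integrable setT (fun w => (eps w ^+ 2)%:E) /\
  (\int[P]_w (eps w)%:E = 0)%E.
Proof.
move=> law.
have mx2 : measurable_fun setT (fun x : R => (x ^+ 2)%:E).
  by apply/measurable_EFinP; exact: measurable_funX.
have mid : measurable_fun setT (@EFin R) by exact/measurable_EFinP.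
have i2 : P.-integrable setT (fun w => (eps w ^+ 2)%:E).
  apply/integrableP; split; first exact: (measurableT_comp mx2).
  under eq_integral do rewrite gee0_abs ?lee_fin ?sqr_ge0//.
  rewrite -(@ge0_integral_distribution _ _ _ _ _ P eps (fun x => (x ^+ 2)%:E))//; last first.
    by move=> x; rewrite lee_fin sqr_ge0.
  have [s0|s0] := eqVneq s 0.
    rewrite (eq_measure_integral \d_(0 : R)); last first.
      by move=> A mA _; rewrite /= /distribution /pushforward law// /centered_gaussian s0 eqxx.
    by rewrite integral_dirac// expr0n mule0 ltry.
  rewrite (eq_measure_integral (pushforward (normal_prob 0 s) to_real)); last first.
    by move=> A mA _; rewrite /= /distribution /pushforward law// /centered_gaussian (negPf s0).
  rewrite ge0_integral_pushforward//; first exact: normal_prob_sqr_lty.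
  by move=> x _; rewrite lee_fin sqr_ge0.
split=> //.
have i1 := integrable_of_sqr (measurable_funPT eps) i2.
rewrite -(@integral_distribution _ _ _ _ _ P eps (@EFin R))//.
have [s0|s0] := eqVneq s 0.
  rewrite (eq_measure_integral \d_(0 : R)); last first.
    by move=> A mA _; rewrite /= /distribution /pushforward law// /centered_gaussian s0 eqxx.
  by rewrite integral_dirac// mule0.
pose nu := distribution P eps.
have nuN (A : set R) : measurable A -> nu ((-%R : R -> R) @^-1` A) = nu A.
  move=> mA; have mNA : measurable ((-%R : R -> R) @^-1` A).
    by rewrite -[X in measurable X]setTI; exact: (@oppr_measurable R setT).
  rewrite /nu /= /distribution /pushforward !law// /centered_gaussian (negPf s0).
  exact: normal_probN.
pose opp : {mfun R >-> R} := HB.pack (-%R : R -> R)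
  (isMeasurableFun.Build _ _ _ _ (-%R : R -> R) (@oppr_measurable R setT)).
have nui : nu.-integrable setT (@EFin R).
  by apply: (@integrable_pushforward _ _ _ _ R eps _ P setT (@EFin R)).
have E : (\int[nu]_x x%:E = - \int[nu]_x x%:E)%E.
  transitivity (\int[pushforward nu opp]_x x%:E)%E.
    by apply: eq_measure_integral => A mA _; exact/esym/nuN.
  have Ni : nu.-integrable setT (@EFin R \o opp).
    exact: (integrableN nui).
  rewrite (@integral_pushforward _ _ _ _ R opp _ nu setT (@EFin R))//=.
  under eq_integral do rewrite EFinN.
  rewrite preimage_setT integralN//; exact: integrable_add_def.
have : (\int[nu]_x x%:E)%E \is a fin_num by exact: integrable_fin_num.
move: E; case: (\int[nu]_x x%:E)%E => // r [rE] _.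
by congr (_%:E); lra.
Qed.

End gaussian.

(** * The kernel as a function of finitely many comparisons *)

Section kernel.
Context (R : realType) (d k : nat) (x : d.-tuple R).
Hypothesis d_gt0 : (0 < d)%N.

(** All comparisons between the dyadic intervals of [z] and of [x] up to depth
    [k], side by side; the kernel is a function of this finite datum. *)
Definition pattern (z : d.-tuple R) : {ffun 'I_d * 'I_k.+1 -> bool} :=
  [ffun jc : 'I_d * 'I_k.+1 => dyadic_index jc.2 (tnth x jc.1) == dyadic_index jc.2 (tnth z jc.1)].

(** Whether the points with pattern [a] lie in the box around [x] obtained by
    splitting [c j] times along each direction [j]: see [hits_pattern]. *)
Definition hits (c : {ffun 'I_d -> 'I_k.+1}) (a : {ffun 'I_d * 'I_k.+1 -> bool}) :=
  [forall j, a (j, c j)].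

(** When [c] sums to [k], the probability that [k] independent uniform split
    directions have the counts [c]. *)
Definition split_prob (c : {ffun 'I_d -> 'I_k.+1}) : R :=
  (k`!)%:R / (\prod_(j < d) (c j)`!)%:R * (1 / d%:R) ^+ k.

Definition pattern_kernel (a : {ffun 'I_d * 'I_k.+1 -> bool}) : R :=
  \sum_(c : {ffun 'I_d -> 'I_k.+1} | (\sum_(j < d) (c j : nat))%N == k)
    split_prob c * (hits c a)%:R.

Lemma centered_kernelE z : centered_kernel k x z = pattern_kernel (pattern z).
Proof.
apply: eq_bigr => c _; congr (_ * _).
have [/forallP h|/forallPn[j]] := boolP (hits c (pattern z)).
  by rewrite big1// => j _; have := h j; rewrite ffunE => ->.
by rewrite ffunE /= => /negPf hj; rewrite (bigD1 j)//= hj mul0r.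
Qed.

Lemma split_prob_ge0 c : 0 <= split_prob c.
Proof. by rewrite mulr_ge0 ?divr_ge0 ?exprn_ge0. Qed.

(** This is the generating function of the multinomial law; the cases [y = 1]
    and [y] equal to [1/2] at one index and [1] elsewhere give its total mass
    and the mean side length of a random box. *)
Lemma sum_split_prob_prod (y : 'I_d -> R) :
  \sum_(c : {ffun 'I_d -> 'I_k.+1} | (\sum_(j < d) (c j : nat))%N == k)
    split_prob c * \prod_j y j ^+ c j = ((\sum_j y j) / d%:R) ^+ k.
Proof.
rewrite mulr_suml -multinomial_theorem; apply: eq_bigr => c /eqP ck.
rewrite /split_prob -[LHS]mulrA; congr (_ * _).
rewrite [RHS](eq_bigr (fun j => y j ^+ c j * (d%:R^-1) ^+ c j)) => [|j _]; last first.
  by rewrite exprMn.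
by rewrite big_split /= prodrXr ck mul1r mulrC.
Qed.

Lemma dR_neq0 : d%:R != 0 :> R.
Proof. by rewrite pnatr_eq0 -lt0n. Qed.

Lemma sum_split_prob :
  \sum_(c : {ffun 'I_d -> 'I_k.+1} | (\sum_(j < d) (c j : nat))%N == k)
    split_prob c = 1.
Proof.
have := sum_split_prob_prod (fun=> 1).
rewrite sumr_const card_ord divff ?dR_neq0// expr1n => <-.
by apply: eq_bigr => c _; rewrite big1 ?mulr1// => j _; rewrite expr1n.
Qed.

Lemma sum_split_prob_contraction i :
  \sum_(c : {ffun 'I_d -> 'I_k.+1} | (\sum_(j < d) (c j : nat))%N == k)
    split_prob c * 2^-1 ^+ c i = (1 - (2 * d%:R)^-1) ^+ k.
Proof.
have := sum_split_prob_prod (fun j => if j == i then 2^-1 else 1).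
have -> : (\sum_(j < d) if j == i then 2^-1 else 1) / d%:R = 1 - (2 * d%:R)^-1 :> R.
  rewrite (bigD1 i)//= eqxx (eq_bigr (fun=> 1)) => [|j /negPf ->//].
  rewrite sumr_const (_ : #|_| = d.-1); last first.
    by rewrite cardC1 card_ord.
  by rewrite -subn1 natrB//; field; exact: dR_neq0.
move=> <-; apply: eq_bigr => c _; rewrite (bigD1 i)//= eqxx big1 ?mulr1//.
by move=> j /negPf ->; rewrite expr1n.
Qed.

Lemma pattern_kernel_ge0 a : 0 <= pattern_kernel a.
Proof. by apply: sumr_ge0 => c _; rewrite mulr_ge0 ?split_prob_ge0. Qed.

Lemma pattern_kernel_le1 a : pattern_kernel a <= 1.
Proof.
rewrite -sum_split_prob; apply: ler_sum => c _.
by rewrite ler_piMr ?split_prob_ge0//; case: hits.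
Qed.

Lemma sum_pattern_kernel (f : {ffun 'I_d * 'I_k.+1 -> bool} -> R) :
  \sum_a f a * pattern_kernel a =
  \sum_(c : {ffun 'I_d -> 'I_k.+1} | (\sum_(j < d) (c j : nat))%N == k)
    split_prob c * \sum_(a | hits c a) f a.
Proof.
under eq_bigr do rewrite mulr_sumr.
rewrite exchange_big /=; apply: eq_bigr => c _.
rewrite mulr_sumr big_mkcond [RHS]big_mkcond; apply: eq_bigr => a _.
by case: (hits c a); rewrite ?mulr1 ?mulr0// mulrC.
Qed.

Lemma measurable_pattern a : measurable (pattern @^-1` [set a]).
Proof.
have -> : pattern @^-1` [set a] = \bigcap_(jc : 'I_d * 'I_k.+1)
    ((fun z => tnth z jc.1) @^-1`
     [set t | (dyadic_index jc.2 (tnth x jc.1) == dyadic_index jc.2 t) = a jc]).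
  apply/seteqP; split => z /=; first by move=> <- jc _ /=; rewrite ffunE.
  by move=> za; apply/ffunP => jc; rewrite ffunE; exact: za.
apply: fin_bigcap_measurable => // jc _.
rewrite -[X in measurable X]setTI; apply: measurable_tnth => //.
pose D := [set t : R | dyadic_index jc.2 t = dyadic_index jc.2 (tnth x jc.1)].
have mD : measurable D by exact: measurable_dyadic_index.
have -> : [set t | (dyadic_index jc.2 (tnth x jc.1) == dyadic_index jc.2 t) = a jc] =
    if a jc then D else ~` D.
  case: (a jc); apply/seteqP; split => t /=; rewrite eq_sym.
  - by move/eqP.
  - by move=> ->; rewrite eqxx.
  - by move=> /eqP.
  - by move=> /eqP/negPf.
by case: (a jc) => //; exact: measurableC.
Qed.

Lemma hits_pattern c z : hits c (pattern z) <->
  forall j, dyadic_index (c j) (tnth z j) = dyadic_index (c j) (tnth x j).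
Proof.
split=> [/forallP h j|h]; first by have := h j; rewrite ffunE /= => /eqP ->.
by apply/forallP => j; rewrite ffunE /= h.
Qed.

(** Whatever the directions of the splits, each of the [k] splits halves the
    volume. *)
Lemma uniform_cube_hits (c : {ffun 'I_d -> 'I_k.+1}) :
  unit_cube x -> (\sum_(j < d) (c j : nat))%N = k ->
  uniform_cube R d [set z | hits c (pattern z)] = (2^-1 ^+ k)%:E.
Proof.
move=> xc ck.
pose A (j : 'I_d) : set R :=
  [set t | dyadic_index (c j) t = dyadic_index (c j) (tnth x j)].
have mA j : measurable (A j) by exact: measurable_dyadic_index.
have -> : [set z | hits c (pattern z)] = [set z | forall j, A j (tnth z j)].
  by apply/seteqP; split => z /=; rewrite hits_pattern.
rewrite (uniform_cube_box mA) /A.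
under eq_bigr do rewrite uniform_dyadic_cell//.
by rewrite prodEFin prodrXr ck.
Qed.

End kernel.

(** * The regression model *)

Definition second_moment d (T : measurableType d) (R : realType)
  (P : probability T R) (Z : T -> R) : R := fine (\int[P]_w (Z w ^+ 2)%:E)%E.

(** [m] is known to be Lipschitz only on the cube, so it may fail to be
    measurable on the whole space. All integrals are therefore written with the
    random variable [Y - eps], which is almost surely equal to [m X]. *)
Section model.
Context (R : realType) (d : nat) (disp : measure_display)
  (T : measurableType disp) (P : probability T R).
Variables (X : {RV P >-> d.-tuple R}) (eps Y : {RV P >-> R})
  (m : d.-tuple R -> R) (L : R).
Hypothesis X_unif : has_law P X (uniform_cube R d).
Hypothesis L_ge0 : 0 <= L.
Hypothesis m_lip : forall x x' : d.-tuple R, unit_cube x -> unit_cube x' ->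
  `|m x - m x'| <= L * \sum_(j < d) `|tnth x j - tnth x' j|.
Hypothesis eps_sqr : P.-integrable setT (fun w => (eps w ^+ 2)%:E).
Hypothesis eps_mean : (\int[P]_w (eps w)%:E = 0)%E.
Hypothesis X_eps_indep : independent_pair P X eps.
Hypothesis Y_def : \forall w \ae P, Y w = m (X w) + eps w.

Lemma second_moment_ge0 : 0 <= second_moment P eps.
Proof. by apply/fine_ge0/integral_ge0 => w _; rewrite lee_fin sqr_ge0. Qed.

Lemma second_momentE : (\int[P]_w (eps w ^+ 2)%:E = (second_moment P eps)%:E)%E.
Proof. by rewrite fineK//; exact: integrable_fin_num. Qed.

Lemma measurable_X (A : set (d.-tuple R)) : measurable A -> measurable (X @^-1` A).
Proof. by move=> mA; exact: measurable_funPTI. Qed.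

Lemma measurable_unit_cube : measurable (@unit_cube R d).
Proof.
have -> : @unit_cube R d = [set z | forall j, `[0, 1]%classic (tnth z j)].
  by apply/seteqP; split => z /= zc j; have := zc j; rewrite /= in_itv.
by apply: (@measurable_box R d (fun=> `[0, 1]%classic)) => j.
Qed.

Lemma ae_X_cube : \forall w \ae P, unit_cube (X w).
Proof.
exists (X @^-1` ~` @unit_cube R d); split => //.
  by apply: measurable_X; apply: measurableC; exact: measurable_unit_cube.
rewrite -preimage_setC probability_setC; last by apply: measurable_X; exact: measurable_unit_cube.
by rewrite X_unif ?uniform_cube_unit_cube ?subee//; exact: measurable_unit_cube.
Qed.

(** Independence of [X] and [eps], in the form of the product law of the
    indicator of [A] at [X] and of [g] at [eps]. *)
Lemma integral_noise (A : set (d.-tuple R)) (g : R -> R) : measurable A ->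
  measurable_fun setT g -> P.-integrable setT (fun w => (g (eps w))%:E) ->
  (\int[P]_(w in X @^-1` A) (g (eps w))%:E =
   P (X @^-1` A) * \int[P]_w (g (eps w))%:E)%E.
Proof.
move=> mA mg gi.
have mEg : measurable_fun setT (EFin \o g) by exact/measurable_EFinP.
have -> : (\int[P]_(w in X @^-1` A) (g (eps w))%:E =
    \int[P]_w (\1_A (X w) * g (eps w))%:E)%E.
  rewrite integral_mkcond; apply: eq_integral => w _; rewrite patchE indicE.
  have -> : (w \in X @^-1` A) = (X w \in A) by apply/idP/idP; rewrite !inE.
  by case: (X w \in A); rewrite ?mul1r ?mul0r.
have mX1 : measurable_fun setT (fun w => \1_A (X w) : R).
  exact: (measurableT_comp (measurable_indic mA)).
rewrite (@integral_product_law _ _ _ _ _ _ _ P X eps (distribution P X)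
  (distribution P eps) 1%:nng _ \1_A g).
- rewrite mul1e integral_indic// setIT.
  by rewrite (@integral_distribution _ _ _ _ _ P eps (EFin \o g)).
- by move=> B C mB mC; rewrite mul1e; exact: X_eps_indep.
- exact: integrable_indic.
- by apply: (@integrable_pushforward _ _ _ _ R eps _ P setT (EFin \o g)).
- apply: le_integrable gi => //.
    apply/measurable_EFinP/measurable_funM => //; exact: measurableT_comp.
  move=> w _ /=; rewrite lee_fin normrM indicE.
  by case: (_ \in _); rewrite ?normr1 ?normr0 ?mul1r ?mul0r.
Qed.

Lemma integral_eps_0 (A : set (d.-tuple R)) : measurable A ->
  (\int[P]_(w in X @^-1` A) (eps w)%:E = 0)%E.
Proof.
move=> mA; rewrite (@integral_noise A idfun)//; [|exact: measurable_id|exact: integrable_of_sqr].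
by rewrite eps_mean mule0.
Qed.

Lemma integral_eps_sqr (A : set (d.-tuple R)) : measurable A ->
  (\int[P]_(w in X @^-1` A) (eps w ^+ 2)%:E = (second_moment P eps)%:E * P (X @^-1` A))%E.
Proof.
move=> mA; rewrite (@integral_noise A (fun t => t ^+ 2))//.
by rewrite second_momentE muleC.
Qed.

Variable x : d.-tuple R.
Hypothesis x_cube : unit_cube x.

Definition residual (w : T) : R := Y w - eps w - m x.

Lemma measurable_residual : measurable_fun setT residual.
Proof. by apply: measurable_funB => //; exact: measurable_funB. Qed.

Lemma ae_residual_le (A : set (d.-tuple R)) (K : R) :
  (forall z, A z -> unit_cube z -> L * \sum_(j < d) `|tnth z j - tnth x j| <= K) ->
  \forall w \ae P, A (X w) -> `|residual w| <= K.
Proof.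
move=> AK; apply: filterS2 Y_def ae_X_cube => w Yw Xw AX.
by rewrite /residual Yw addrK; apply: le_trans (m_lip Xw x_cube) (AK _ AX Xw).
Qed.

(** [K] is a bound on the oscillation of [m] around [x] over the part of [A] in
    the cube, where [X] lies almost surely. *)
Lemma abse_integral_residual_le (A : set (d.-tuple R)) (K : R) : measurable A -> 0 <= K ->
  (forall z, A z -> unit_cube z -> L * \sum_(j < d) `|tnth z j - tnth x j| <= K) ->
  (`|\int[P]_(w in X @^-1` A) (residual w)%:E| <= K%:E * P (X @^-1` A))%E.
Proof.
move=> mA K0 AK; have mXA := measurable_X mA.
have mr : measurable_fun (X @^-1` A) (EFin \o residual).
  by apply/measurable_EFinP/measurable_funTS; exact: measurable_residual.
apply: (le_trans (le_abse_integral _ mXA mr)).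
rewrite -integral_cst//; apply: ae_ge0_le_integral => //.
  exact: measurableT_comp.
by apply: filterS (ae_residual_le AK) => w rw /rw; rewrite /= lee_fin.
Qed.

Lemma cube_dist_le z : unit_cube z ->
  L * \sum_(j < d) `|tnth z j - tnth x j| <= L * d%:R.
Proof.
move=> zc; rewrite ler_wpM2l// -[d in leRHS]card_ord -sumr_const.
apply: ler_sum => j _; rewrite ler_norml.
by have /andP[? ?] := zc j; have /andP[? ?] := x_cube j; lra.
Qed.

(** The deviation [Y - m x] is the sum of the residual, which is bounded by
    [L d], and of the noise; the square of the sum is at most twice the sum of
    the squares. *)
Lemma integral_sqr_deviation_le (A : set (d.-tuple R)) : measurable A ->
  (\int[P]_(w in X @^-1` A) ((Y w - m x) ^+ 2)%:E <=
   (2 * (L * d%:R) ^+ 2 + 2 * second_moment P eps)%:E * P (X @^-1` A))%E.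
Proof.
move=> mA; have mXA := measurable_X mA.
have meps2 : measurable_fun setT (fun w => eps w ^+ 2) by exact: measurable_funX.
apply: (@le_trans _ _ (\int[P]_(w in X @^-1` A)
    ((2 * (L * d%:R) ^+ 2)%:E + 2%:E * (eps w ^+ 2)%:E)%E)%E).
  apply: ae_ge0_le_integral => //.
  - by move=> w _; rewrite lee_fin sqr_ge0.
  - apply/measurable_EFinP/measurable_funX/measurable_funTS/measurable_funB => //.
  - by move=> w _; rewrite -EFinM -EFinD lee_fin; apply: addr_ge0; rewrite mulr_ge0 ?sqr_ge0.
  - apply: emeasurable_funD => //; apply: emeasurable_funM => //.
    exact/measurable_EFinP/measurable_funTS.
  - apply: filterS (@ae_residual_le setT _ (fun z _ => @cube_dist_le z)) => w /(_ I) rw _.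
    rewrite -EFinM -EFinD lee_fin.
    have -> : Y w - m x = residual w + eps w by rewrite /residual; ring.
    have r2 : residual w ^+ 2 <= (L * d%:R) ^+ 2.
      by rewrite -[leLHS]real_normK ?num_real// ler_sqr ?nnegrE// mulr_ge0.
    have := sqr_ge0 (residual w - eps w); lra.
rewrite ge0_integralD//; last 3 first.
- by move=> w _; rewrite lee_fin mulr_ge0 ?sqr_ge0.
- by move=> w _; rewrite -EFinM lee_fin mulr_ge0 ?sqr_ge0.
- by apply: emeasurable_funM => //; exact/measurable_EFinP/measurable_funTS.
rewrite integral_cst// ge0_integralZl//; last 2 first.
- by apply/measurable_EFinP/measurable_funTS.
- by move=> w _; rewrite lee_fin sqr_ge0.
rewrite integral_eps_sqr// muleA -EFinM -ge0_muleDl ?EFinD// lee_fin.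
  by rewrite mulr_ge0 ?sqr_ge0.
by rewrite mulr_ge0 ?second_moment_ge0.
Qed.

Lemma integrable_sqr_deviation : P.-integrable setT (fun w => ((Y w - m x) ^+ 2)%:E).
Proof.
apply/integrableP; split.
  by apply/measurable_EFinP/measurable_funX/measurable_funB.
under eq_integral do rewrite gee0_abs ?lee_fin ?sqr_ge0//.
rewrite -[X in integral _ X](@preimage_setT _ _ X).
apply: le_lt_trans (integral_sqr_deviation_le measurableT) _.
by rewrite preimage_setT probability_setT mule1 ltry.
Qed.

(** The noise contributes nothing to an integral over an event that depends
    only on [X]. *)
Lemma integral_deviation (A : set (d.-tuple R)) : measurable A ->
  (\int[P]_(w in X @^-1` A) (Y w - m x)%:E =
   \int[P]_(w in X @^-1` A) (residual w)%:E)%E.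
Proof.
move=> mA; have mXA := measurable_X mA.
have Yi : P.-integrable setT (fun w => (Y w - m x)%:E).
  by apply: integrable_of_sqr integrable_sqr_deviation; exact: measurable_funB.
have epsi : P.-integrable setT (fun w => (eps w)%:E) by exact: integrable_of_sqr.
have -> : (\int[P]_(w in X @^-1` A) (residual w)%:E =
    \int[P]_(w in X @^-1` A) ((Y w - m x)%:E - (eps w)%:E))%E.
  by apply: eq_integral => w _; rewrite -EFinB /residual; congr (_%:E); ring.
rewrite integralB//.
- by rewrite integral_eps_0// sube0.
- exact: integrableS Yi.
- exact: integrableS epsi.
Qed.

End model.

(** * Risk of the estimator at a fixed depth *)

Section kerf_risk.
Context (R : realType) (d : nat) (disp : measure_display)
  (T : measurableType disp) (P : probability T R).
Variables (X : {RV P >-> d.-tuple R}) (eps Y : {RV P >-> R})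
  (m : d.-tuple R -> R) (L : R).
Hypothesis d_gt0 : (0 < d)%N.
Hypothesis X_unif : has_law P X (uniform_cube R d).
Hypothesis L_ge0 : 0 <= L.
Hypothesis m_lip : forall x x' : d.-tuple R, unit_cube x -> unit_cube x' ->
  `|m x - m x'| <= L * \sum_(j < d) `|tnth x j - tnth x' j|.
Hypothesis eps_sqr : P.-integrable setT (fun w => (eps w ^+ 2)%:E).
Hypothesis eps_mean : (\int[P]_w (eps w)%:E = 0)%E.
Hypothesis X_eps_indep : independent_pair P X eps.
Hypothesis Y_def : \forall w \ae P, Y w = m (X w) + eps w.
Variables (k : nat) (x : d.-tuple R).
Hypothesis x_cube : unit_cube x.

Local Notation label := (fun w => pattern k x (X w)).
Local Notation pattern_set a := (X @^-1` (pattern k x @^-1` [set a])).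

Lemma measurable_pattern_set a : measurable (pattern_set a).
Proof. by apply: measurable_X; exact: measurable_pattern. Qed.

Definition pattern_prob a : R := fine (P (pattern_set a)).
Definition pattern_mean a : R := fine (\int[P]_(w in pattern_set a) (Y w - m x)%:E)%E.

Lemma pattern_probE a : P (pattern_set a) = (pattern_prob a)%:E.
Proof. by rewrite fineK// fin_num_measure//; exact: measurable_pattern_set. Qed.

Lemma pattern_prob_ge0 a : 0 <= pattern_prob a.
Proof. exact: fine_ge0. Qed.

Lemma measurable_deviation : measurable_fun setT (fun w => Y w - m x).
Proof. exact: measurable_funB. Qed.

Lemma integrable_deviation : P.-integrable setT (fun w => (Y w - m x)%:E).
Proof.
apply: integrable_of_sqr measurable_deviation _.
exact: (integrable_sqr_deviation X_unif L_ge0 m_lip eps_sqr X_eps_indep Y_def x_cube).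
Qed.

Lemma pattern_meanE a :
  (\int[P]_(w in pattern_set a) (Y w - m x)%:E = (pattern_mean a)%:E)%E.
Proof.
rewrite fineK//; apply: integrable_fin_num; first exact: measurable_pattern_set.
by apply: integrableS integrable_deviation => //; exact: measurable_pattern_set.
Qed.

Lemma norm_pattern_mean_le a : `|pattern_mean a| <= L * d%:R * pattern_prob a.
Proof.
have ma := @measurable_pattern R d k x a.
have := abse_integral_residual_le X_unif m_lip Y_def x_cube ma
  (mulr_ge0 L_ge0 (ler0n _ d)) (fun z _ => @cube_dist_le R d L L_ge0 x x_cube z).
rewrite -(integral_deviation X_unif L_ge0 m_lip eps_sqr eps_mean X_eps_indep Y_def x_cube)//.
by rewrite pattern_meanE pattern_probE -EFinM abse_EFin lee_fin.
Qed.

Lemma integral_hits (c : {ffun 'I_d -> 'I_k.+1}) (f : T -> R) :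
  measurable_fun setT f ->
  (\int[P]_(w in X @^-1` [set z | hits c (pattern k x z)]) (f w)%:E =
   \sum_(a | hits c a) \int[P]_(w in pattern_set a) (f w)%:E)%E.
Proof.
exact: (@integral_label_partition _ _ _ P _ label (hits c) f measurable_pattern_set).
Qed.

Lemma measurable_hits (c : {ffun 'I_d -> 'I_k.+1}) :
  measurable [set z | hits c (pattern k x z)].
Proof.
have -> : [set z | hits c (pattern k x z)] =
    \bigcup_(a in [set a | hits c a]) (pattern k x @^-1` [set a]).
  by apply/seteqP; split => [z /= h|z [a /= ha ->]//]; exists (pattern k x z).
by apply: fin_bigcup_measurable => // a _; exact: measurable_pattern.
Qed.

Lemma sum_hits_prob (c : {ffun 'I_d -> 'I_k.+1}) : (\sum_(j < d) (c j : nat))%N = k ->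
  \sum_(a | hits c a) pattern_prob a = 2^-1 ^+ k.
Proof.
move=> ck; apply: EFin_inj.
rewrite -(uniform_cube_hits x_cube ck) -X_unif; last exact: measurable_hits.
have := @integral_hits c (fun=> 1) (measurable_cst _).
rewrite integral_cst; last by apply: measurable_X; exact: measurable_hits.
rewrite mul1e => ->; rewrite -sumEFin; apply: eq_bigr => a _.
rewrite integral_cst; first by rewrite mul1e; exact/esym/pattern_probE.
exact: measurable_pattern_set.
Qed.

(** The bias on a single box: its side along direction [j] has length
    [2^-(c j)], and its probability is [2^-k]. *)
Lemma norm_sum_hits_mean (c : {ffun 'I_d -> 'I_k.+1}) :
  (\sum_(j < d) (c j : nat))%N = k ->
  `|\sum_(a | hits c a) pattern_mean a| <=
  (L * \sum_j 2^-1 ^+ c j) * 2^-1 ^+ k.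
Proof.
move=> ck; have mh := measurable_hits c.
have K0 : 0 <= L * \sum_(j < d) 2^-1 ^+ c j.
  by rewrite mulr_ge0// sumr_ge0// => j _; rewrite exprn_ge0.
have hK z : hits c (pattern k x z) -> unit_cube z ->
    L * \sum_(j < d) `|tnth z j - tnth x j| <= L * \sum_(j < d) 2^-1 ^+ c j.
  move=> /hits_pattern hz _; rewrite ler_wpM2l//; apply: ler_sum => j _.
  exact/dyadic_index_dist.
have := abse_integral_residual_le X_unif m_lip Y_def x_cube mh K0 hK.
rewrite -(integral_deviation X_unif L_ge0 m_lip eps_sqr eps_mean X_eps_indep Y_def x_cube)//.
rewrite integral_hits; last exact: measurable_deviation.
under eq_bigr do rewrite pattern_meanE.
rewrite sumEFin abse_EFin X_unif// uniform_cube_hits// -EFinM lee_fin.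
Qed.

Lemma mean_pattern_kernel : mean pattern_prob (@pattern_kernel R d k) = 2^-1 ^+ k.
Proof.
rewrite /mean sum_pattern_kernel.
rewrite (eq_bigr (fun c => split_prob R c * 2^-1 ^+ k)) => [|c /eqP ck].
  by rewrite -mulr_suml sum_split_prob// mul1r.
by rewrite sum_hits_prob.
Qed.

Definition pattern_regression a : R := pattern_mean a / pattern_prob a.

(** If a pattern has probability zero, both sides vanish, since the integral
    over it is dominated by its probability. *)
Lemma pattern_regressionE a : pattern_regression a * pattern_prob a = pattern_mean a.
Proof.
rewrite /pattern_regression; have [p0|p0] := eqVneq (pattern_prob a) 0.
  have := norm_pattern_mean_le a; rewrite p0 mulr0 normr_le0 => /eqP ->.
  by rewrite mul0r mulr0.
by rewrite divfK.
Qed.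

Lemma norm_pattern_regression_le a : `|pattern_regression a| <= L * d%:R.
Proof.
rewrite /pattern_regression; have [p0|p0] := eqVneq (pattern_prob a) 0.
  by rewrite p0 invr0 mulr0 normr0 mulr_ge0.
have pgt : 0 < pattern_prob a by rewrite lt_neqAle eq_sym p0 pattern_prob_ge0.
rewrite normrM normfV (gtr0_norm pgt) ler_pdivrMr//; exact: norm_pattern_mean_le.
Qed.

(** The bias: averaging the side lengths of the boxes over the random splits
    turns [2^-(c j)] into [(1 - 1/(2d))^k], for each of the [d] directions. *)
Lemma mean_kernel_regression_le :
  `|mean pattern_prob (fun a => pattern_kernel R a * pattern_regression a)| <=
  L * d%:R * (1 - (2 * d%:R)^-1) ^+ k * 2^-1 ^+ k.
Proof.
have -> : mean pattern_prob (fun a => pattern_kernel R a * pattern_regression a) =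
    \sum_a pattern_mean a * pattern_kernel R a.
  by apply: eq_bigr => a _; rewrite -pattern_regressionE; ring.
rewrite sum_pattern_kernel; apply: (le_trans (ler_norm_sum _ _ _)).
apply: (@le_trans _ _ (\sum_(c : {ffun 'I_d -> 'I_k.+1} | (\sum_(j < d) (c j : nat))%N == k)
    \sum_j (split_prob R c * 2^-1 ^+ c j) * (L * 2^-1 ^+ k))).
  apply: ler_sum => c /eqP ck.
  rewrite normrM ger0_norm ?split_prob_ge0// -mulr_suml -mulr_sumr -mulrA.
  rewrite ler_wpM2l ?split_prob_ge0//; apply: le_trans (norm_sum_hits_mean ck) _.
  by rewrite mulrA [L * _]mulrC.
rewrite exchange_big /= (eq_bigr (fun=> (1 - (2 * d%:R)^-1) ^+ k * (L * 2^-1 ^+ k))).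
  by rewrite sumr_const card_ord -mulr_natr le_eqVlt; apply/orP; left; apply/eqP; ring.
by move=> j _; rewrite -mulr_suml sum_split_prob_contraction.
Qed.

Section sample.
Variables (Xs : nat -> {RV P >-> d.-tuple R}) (Ys : nat -> {RV P >-> R}).
Hypothesis sample_copies :
  independent_copies P (fun i w => (Xs i w, Ys i w)) (fun w => (X w, Y w)).

(** The estimator minus [m x] is a locally weighted average of the [Y - m x],
    except that it is [- m x] when all weights vanish. The constants come from
    [partition_risk_le] with [B = L d], [Q = 2 (L d)^2 + 2 E eps^2] and
    [c = - m x]. *)
Lemma kerf_risk_le (n : nat) : (0 < n)%N ->
  ('E_P[fun w : T => ((centered_kerf k n (Xs ^~ w) (Ys ^~ w) x - m x) ^+ 2)%R] <=
   ((12 * (L * d%:R) ^+ 2 + 8 * second_moment P eps + m x ^+ 2) * (2 ^+ k / n%:R) +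
    2 * (L * d%:R * (1 - (2 * d%:R)^-1) ^+ k) ^+ 2)%:E)%E.
Proof.
move=> n0.
have mpair (X' : {RV P >-> d.-tuple R}) (Y' : {RV P >-> R}) :
    measurable_fun setT (fun w => (X' w, Y' w)) by exact: measurable_fun_pair.
pose Z0 : {mfun T >-> (d.-tuple R * R)%type} :=
  HB.pack (fun w => (X w, Y w)) (isMeasurableFun.Build _ _ _ _ _ (mpair X Y)).
pose Z i : {mfun T >-> (d.-tuple R * R)%type} :=
  HB.pack (fun w => (Xs i w, Ys i w))
    (isMeasurableFun.Build _ _ _ _ _ (mpair (Xs i) (Ys i))).
pose G (u : d.-tuple R * R) := pattern k x u.1.
pose V (u : d.-tuple R * R) := u.2 - m x.
have mG a : measurable (G @^-1` [set a]).
  have mfst : measurable_fun setT (fst : d.-tuple R * R -> d.-tuple R) by exact: measurable_fst.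
  have := mfst measurableT _ (@measurable_pattern R d k x a).
  by rewrite setTI.
have mV : measurable_fun setT V by exact: measurable_funB.
have V2 : P.-integrable setT (fun w => (V (Z0 w) ^+ 2)%:E).
  exact: (integrable_sqr_deviation X_unif L_ge0 m_lip eps_sqr X_eps_indep Y_def x_cube).
have [Z_indep Z_law] := sample_copies.
have q0 : 0 < mean pattern_prob (@pattern_kernel R d k).
  by rewrite mean_pattern_kernel exprn_gt0 ?invr_gt0.
have VE a : (\int[P]_(w in Z0 @^-1` (G @^-1` [set a])) (V (Z0 w))%:E =
    (pattern_regression a * pattern_prob a)%:E)%E.
  by rewrite pattern_regressionE; exact: pattern_meanE.
have V2E a : (\int[P]_(w in Z0 @^-1` (G @^-1` [set a])) (V (Z0 w) ^+ 2)%:E <=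
    ((2 * (L * d%:R) ^+ 2 + 2 * second_moment P eps) * pattern_prob a)%:E)%E.
  rewrite EFinM -pattern_probE.
  apply: (integral_sqr_deviation_le X_unif L_ge0 m_lip eps_sqr X_eps_indep Y_def x_cube).
  exact: measurable_pattern.
have B0 : 0 <= L * d%:R by rewrite mulr_ge0.
have Q0 : 0 <= 2 * (L * d%:R) ^+ 2 + 2 * second_moment P eps.
  by rewrite addr_ge0// mulr_ge0 ?sqr_ge0 ?second_moment_ge0.
have := @partition_risk_le _ T R P _ _ Z0 Z Z_indep Z_law _ G mG n V mV V2
  (@pattern_kernel R d k) pattern_regression (L * d%:R) _ (- m x)
  (@pattern_kernel_ge0 R d k) (@pattern_kernel_le1 R d k d_gt0)
  B0 Q0 norm_pattern_regression_le VE V2E n0 q0.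
rewrite unlock.
rewrite (eq_integral (fun w =>
    ((centered_kerf k n (Xs ^~ w) (Ys ^~ w) x - m x) ^+ 2)%:E)); last first.
  move=> w _; congr ((_ ^+ 2)%:E); rewrite /partition_error /V /=.
  have -> : centered_kerf k n (Xs ^~ w) (Ys ^~ w) x =
      (\sum_(i < n) Ys i w * pattern_kernel R (G (Z i w))) /
      (\sum_(i < n) pattern_kernel R (G (Z i w))).
    by congr (_ / _); apply: eq_bigr => i _; rewrite centered_kernelE.
  under eq_bigr do rewrite mulrBl.
  rewrite sumrB -mulr_sumr mulrBl.
  have [->|S0] := eqVneq (\sum_(i < n) pattern_kernel R (G (Z i w))) 0.
    by rewrite invr0 !mulr0 mulr1 subr0 !add0r.
  by rewrite mulfK// mulr0 addr0.
move=> /le_trans; apply; rewrite lee_fin mean_pattern_kernel.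
have p2 : (2^-1 : R) ^+ k != 0 by rewrite expf_neq0// invr_eq0.
apply: lerD.
  rewrite sqrrN invfM -exprVn invrK [_^-1 * _]mulrC.
  by rewrite le_eqVlt; apply/orP; left; apply/eqP; congr (_ * _); ring.
rewrite ler_pM2l// -ler_sqrt ?sqr_ge0// !sqrtr_sqr.
rewrite normrM normfV [in X in _ / X]ger0_norm ?exprn_ge0// ler_pdivrMr ?exprn_gt0//.
apply: le_trans mean_kernel_regression_le _.
by rewrite ler_wpM2r ?exprn_ge0// ler_norm.
Qed.
End sample.
End kerf_risk.

(** * Choice of the depth *)

Section depth.
Context (R : realType) (d : nat).
Hypothesis d_gt0 : (0 < d)%N.

Definition rate_denom : R := 1 + d%:R * ln 2.
Definition depth (n : nat) : nat := Num.truncn (d%:R * ln n%:R / rate_denom : R).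

Lemma ln2_gt0 : 0 < ln 2 :> R.
Proof. by rewrite ln_gt0// ltr1n. Qed.

Lemma rate_denom_gt0 : 0 < rate_denom.
Proof. by rewrite ltr_wpDr// mulr_ge0// ltW// ln2_gt0. Qed.

Lemma depth_cvg : depth n @[n --> \oo] --> \oo.
Proof.
have d0 : 0 < d%:R :> R by rewrite ltr0n.
apply/cvgnyPge => A.
exists (Num.truncn (expR (A%:R * rate_denom / d%:R) : R)).+1 => //.
move=> n /=; rewrite -(ler_nat R) => /(lt_le_trans (truncnS_gt _)) An.
have n0 : 0 < n%:R :> R by apply: lt_trans An; exact: expR_gt0.
have n1 : 1 <= n%:R :> R by move: n0; rewrite ltr0n ler1n.
rewrite /depth truncn_ge_nat; last first.
  by rewrite !mulr_ge0 ?ln_ge0 ?invr_ge0// ltW// rate_denom_gt0.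
rewrite ler_pdivlMr ?rate_denom_gt0// [leRHS]mulrC -ler_pdivrMr//.
by rewrite -ler_expR lnK ?posrE// ltW.
Qed.

(** Rounding down makes [2^k] at most [n^(d log 2 / (1 + d log 2))]. *)
Lemma exp2_depth_le n : (0 < n)%N ->
  2 ^+ depth n / n%:R <= n%:R `^ (- (1 / rate_denom)) :> R.
Proof.
move=> n0; have nR : 0 < n%:R :> R by rewrite ltr0n.
have r0 := rate_denom_gt0.
have ln0 : 0 <= ln n%:R :> R by rewrite ln_ge0// ler1n.
rewrite /powR gt_eqF//.
have -> : 2 ^+ depth n / n%:R = expR ((depth n)%:R * ln 2 - ln n%:R) :> R.
  by rewrite expRB lnK ?posrE// expRM_natl lnK// posrE.
rewrite ler_expR.
have kle : (depth n)%:R <= d%:R * ln n%:R / rate_denom.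
  by rewrite truncn_le !mulr_ge0 ?invr_ge0// ltW.
have := ler_wpM2r (ltW ln2_gt0) kle.
have -> : - (1 / rate_denom) * ln n%:R =
    d%:R * ln n%:R / rate_denom * ln 2 - ln n%:R.
  by rewrite /rate_denom; field; exact: lt0r_neq0.
lra.
Qed.

(** Rounding down loses less than one unit of depth, hence the factor
    [exp (1/d)]. *)
Lemma contraction_depth_le n : (0 < n)%N ->
  ((1 - (2 * d%:R)^-1) ^+ depth n) ^+ 2 <=
  expR (d%:R^-1) * n%:R `^ (- (1 / rate_denom)) :> R.
Proof.
move=> n0; have nR : 0 < n%:R :> R by rewrite ltr0n.
have d0 : 0 < d%:R :> R by rewrite ltr0n.
have r0 := rate_denom_gt0.
have ln0 : 0 <= ln n%:R :> R by rewrite ln_ge0// ler1n.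
have half : (2 * d%:R)^-1 <= 1 :> R.
  rewrite invf_le1 ?mulr_gt0//.
  have : 1 <= d%:R :> R by rewrite ler1n.
  lra.
apply: (@le_trans _ _ (expR (- (depth n)%:R / d%:R))).
  apply: (@le_trans _ _ ((expR (- (2 * d%:R)^-1) ^+ depth n) ^+ 2)).
    rewrite ler_sqr ?nnegrE ?exprn_ge0 ?subr_ge0 ?expR_ge0//.
    by rewrite lerXn2r ?nnegrE ?subr_ge0 ?expR_ge0// expR_ge1Dx.
  rewrite -!expRM_natl le_eqVlt; apply/orP; left; apply/eqP; congr expR.
  by field; rewrite lt0r_neq0.
rewrite /powR gt_eqF// -expRD ler_expR.
have kge : d%:R * ln n%:R / rate_denom - 1 <= (depth n)%:R.
  by rewrite lerBlDr natr1 ltW// truncnS_gt.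
rewrite -subr_ge0.
have -> : d%:R^-1 + - (1 / rate_denom) * ln n%:R - - (depth n)%:R / d%:R =
    ((depth n)%:R - (d%:R * ln n%:R / rate_denom - 1)) / d%:R.
  by field; rewrite !lt0r_neq0.
by rewrite divr_ge0// ?subr_ge0// ltW.
Qed.

End depth.

Theorem theorem1 (R : realType) (d : nat) (d_ge1 : (1 <= d)%N)
  (m : d.-tuple R -> R) (m_lip : lipschitz_on_cube m)
  (disp : measure_display) (T : measurableType disp) (P : probability T R)
  (X : {RV P >-> d.-tuple R}) (eps Y : {RV P >-> R})
  (X_unif : has_law P X (uniform_cube R d))
  (s : R) (s_ge0 : 0 <= s) (eps_gauss : has_law P eps (centered_gaussian s))
  (X_eps_indep : independent_pair P X eps)
  (Y_def : \forall w \ae P, Y w = m (X w) + eps w)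
  (Xs : nat -> {RV P >-> d.-tuple R}) (Ys : nat -> {RV P >-> R})
  (sample_copies :
     independent_copies P (fun i w => (Xs i w, Ys i w)) (fun w => (X w, Y w))) :
  exists (k : nat -> nat) (C : R),
    k n @[n --> \oo] --> \oo /\
    forall (n : nat) (x : d.-tuple R), (1 < n)%N -> unit_cube x ->
      ('E_P[fun w : T =>
              ((centered_kerf (k n) n (Xs ^~ w) (Ys ^~ w) x - m x) ^+ 2)%R]
        <= (C * n%:R `^ (- (1 / (1 + d%:R * ln 2))) * ln n%:R)%:E)%E.
Proof.
have [L0 m_lip0] := m_lip; pose L := `|L0|.
have L_ge0 : 0 <= L by exact: normr_ge0.
have m_lipL (x x' : d.-tuple R) : unit_cube x -> unit_cube x' ->
    `|m x - m x'| <= L * \sum_(j < d) `|tnth x j - tnth x' j|.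
  move=> xc xc'; apply: le_trans (m_lip0 _ _ xc xc') _.
  by rewrite ler_wpM2r ?sumr_ge0// ler_norm.
have [eps_sqr eps_mean] := gaussian_moments eps_gauss.
(* The constant must not depend on [x]: [m x] is bounded through the origin. *)
pose origin : d.-tuple R := [tuple 0 | _ < d].
have origin_cube : unit_cube origin by move=> j; rewrite tnth_mktuple lexx ler01.
pose M := `|m origin| + L * d%:R.
have m_le x : unit_cube x -> m x ^+ 2 <= M ^+ 2.
  move=> xc; rewrite -[leLHS]real_normK ?num_real// ler_sqr ?nnegrE ?addr_ge0 ?mulr_ge0//.
  rewrite -[m x](subrK (m origin)) addrC; apply: le_trans (ler_normD _ _) _.
  rewrite lerD2l; apply: le_trans (m_lipL _ _ xc origin_cube) _.
  exact: cube_dist_le.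
pose A1 := 12 * (L * d%:R) ^+ 2 + 8 * second_moment P eps + M ^+ 2.
pose A2 := 2 * (L * d%:R) ^+ 2.
exists (depth R d), ((A1 + A2 * expR (d%:R^-1)) / ln 2); split.
  exact: depth_cvg.
move=> n x n1 xc; have n0 : (0 < n)%N by exact: ltnW.
apply: le_trans (kerf_risk_le d_ge1 X_unif L_ge0 m_lipL eps_sqr eps_mean
  X_eps_indep Y_def (depth R d n) xc sample_copies n0) _.
rewrite lee_fin -/(rate_denom R d).
set p := n%:R `^ _.
have A1_ge0 : 0 <= A1.
  by rewrite !addr_ge0 ?sqr_ge0// mulr_ge0 ?sqr_ge0 ?second_moment_ge0.
have A2_ge0 : 0 <= A2 by rewrite mulr_ge0 ?sqr_ge0.
apply: (@le_trans _ _ ((A1 + A2 * expR (d%:R^-1)) * p)).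
  rewrite [leRHS]mulrDl; apply: lerD.
    apply: ler_pM; rewrite ?divr_ge0 ?exprn_ge0//.
    - by rewrite !addr_ge0 ?sqr_ge0// mulr_ge0 ?sqr_ge0 ?second_moment_ge0.
    - by rewrite lerD2l; exact: m_le.
    - exact: exp2_depth_le.
  by rewrite exprMn mulrA -[leRHS]mulrA ler_wpM2l//; exact: contraction_depth_le.
set K := A1 + _.
have -> : K / ln 2 * p * ln n%:R = K * p * (ln n%:R / ln 2) by ring.
have K0 : 0 <= K * p.
  by rewrite mulr_ge0 ?powR_ge0// addr_ge0// mulr_ge0 ?expR_ge0.
rewrite ler_peMr//.
rewrite ler_pdivlMr ?ln2_gt0// mul1r ler_ln ?posrE ?ltr0n//.
by rewrite ler_nat.
Qed.
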